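(* Let $X$ be a continuous random variable with probability density function $f$ whose support is the interval $(L,R)$, where $-\infty\le L<R\le\infty$, and suppose $f$ is continuous on $(L,R)$. Let $p$ be a real number in the interior of $\mathcal{D}=\{p\ge 1: E[|X|^{p-1}]<\infty\}$, let $\nu_p$ be the $p$-mean of $X$, and let $$H_p=\int_0^{\nu_p-L} y^{p-1} f(\nu_p-y)\,dy=\int_0^{R-\nu_p} y^{p-1} f(\nu_p+y)\,dy.$$ If a random variable with density $\frac{1}{H_p}y^{p-1}f(\nu_p+y)\mathbf{1}_{(0,R-\nu_p)}(y)$ exhibits strict stochastic dominance over a random variable with density $\frac{1}{H_p}y^{p-1}f(\nu_p-y)\mathbf{1}_{(0,\nu_p-L)}(y)$, then the function $q\mapsto\nu_q$ is increasing at $p$ (its derivative at $p$ is positive). Consequently, if this stochastic dominance holds for every $p$ in the interior of $\mathcal{D}$, then $X$ is truly positively skewed.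
   Context: For $p\ge 1$ and a continuous random variable $X$ with $E[|X|^{p-1}]<\infty$, the $p$-mean $\nu_p$ is the unique real solution $\nu$ of $E[(X-\nu)_+^{p-1}]=E[(\nu-X)_+^{p-1}]$ (for $p=1$ this is the median). The domain of $p\mapsto\nu_p$ is $\mathcal{D}=\{p\ge1:E[|X|^{p-1}]<\infty\}$. A random variable $Y$ with CDF $F_Y$ exhibits strict stochastic dominance over $Z$ with CDF $F_Z$ if $F_Z(x)\ge F_Y(x)$ for all $x$ and $F_Z\not\equiv F_Y$. $X$ is called truly positively skewed if $p\mapsto \nu_p$ is increasing on $\mathcal{D}$, provided the interior of $\mathcal{D}$ is nonempty. *)

(* Defs.v *)
From HB Require Import structures.
From mathcomp Require Import all_boot all_order all_algebra.
From mathcomp Require Import all_classical all_reals all_analysis.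
Set Implicit Arguments. Unset Strict Implicit. Unset Printing Implicit Defensive.
Import Order.TTheory GRing.Theory Num.Theory.
Import numFieldNormedType.Exports.
Local Open Scope classical_set_scope.
Local Open Scope ring_scope.

(* (a)_+^(q-1), with the convention that it is 0 for a <= 0
   (so for q = 1 it is the indicator of a > 0, giving the median). *)
Definition ppow (R : realType) (a q : R) : R :=
  if 0 < a then a `^ (q - 1) else 0.

Definition is_density (R : realType) (f : R -> R) : Prop :=
  measurable_fun setT f /\ (forall x, 0 <= f x) /\
  (\int[lebesgue_measure]_x (f x)%:E = 1)%E.

Definition pdomain (R : realType) (f : R -> R) : set R :=
  [set q | 1 <= q /\
     (\int[lebesgue_measure]_x ((`|x| `^ (q - 1)) * f x)%:E < +oo)%E].

Definition is_pmean (R : realType) (f : R -> R) (q nu : R) : Prop :=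
  (\int[lebesgue_measure]_x (ppow (x - nu) q * f x)%:E =
   \int[lebesgue_measure]_x (ppow (nu - x) q * f x)%:E)%E.

Definition Hp (R : realType) (f : R -> R) (L : \bar R) (nu p : R) : R :=
  fine (\int[lebesgue_measure]_(y in [set y : R | 0 < y /\ (y%:E < nu%:E - L)%E])
          (y `^ (p - 1) * f (nu - y))%:E).

Definition gplus (R : realType) (f : R -> R) (L Rb : \bar R) (nu p : R) (y : R) : R :=
  (Hp f L nu p)^-1 * (y `^ (p - 1) * f (nu + y)) *
  \1_([set y : R | 0 < y /\ (y%:E < Rb - nu%:E)%E]) y.

Definition gminus (R : realType) (f : R -> R) (L : \bar R) (nu p : R) (y : R) : R :=
  (Hp f L nu p)^-1 * (y `^ (p - 1) * f (nu - y)) *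
  \1_([set y : R | 0 < y /\ (y%:E < nu%:E - L)%E]) y.

Definition cdf (R : realType) (g : R -> R) (x : R) : \bar R :=
  \int[lebesgue_measure]_(y in `]-oo, x]) (g y)%:E.

Definition strict_dominance (R : realType) (gY gZ : R -> R) : Prop :=
  (forall x, (cdf gY x <= cdf gZ x)%E) /\ cdf gZ <> cdf gY.

Definition truly_pos_skewed (R : realType) (f : R -> R) (nu : R -> R) : Prop :=
  (exists p : R, interior (pdomain f) p) /\
  (forall q1 q2, pdomain f q1 -> pdomain f q2 -> q1 < q2 -> nu q1 < nu q2).

(* Main.v *)
Require Import Defs.
From HB Require Import structures.
From mathcomp Require Import all_boot all_order all_algebra.
From mathcomp Require Import all_classical all_reals all_analysis.
From mathcomp Require Import measurable_realfun lra ring.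
Set Implicit Arguments. Unset Strict Implicit. Unset Printing Implicit Defensive.
Import Order.TTheory GRing.Theory Num.Theory.
Import numFieldNormedType.Exports.
Local Open Scope classical_set_scope.
Local Open Scope ring_scope.

(* Write [spow q u] for the odd power [sgn(u) |u|^(q-1)].  The p-mean [nu q] is the zero of
   [M(q, v) = E (spow q (X - v))], which is decreasing in [v].  From
   [0 = M(q, nu q) - M(p, nu p)] one gets, exactly,
   [(nu q - nu p) * E (S q) = (q - p) * E (T q)], where [S q] is the difference quotient
   in [v] of [spow q (X - v)] between [nu p] and [nu q], and [T q] the difference quotient
   in the exponent at [v = nu p].  By dominated convergence
   [E (S q) -> (p - 1) E |X - nu p|^(p-2) > 0] and
   [E (T q) -> E (spow p (X - nu p) ln |X - nu p|)] as [q -> p], so [nu] is differentiable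
   at [p].  The second limit is [H_p (E ln Y - E ln Z)], where [Y] and [Z] have the two
   densities of the statement; strict dominance makes it positive, because
   [E ln Y - E ln Z] is the integral of [(F_Z - F_Y)(x) dx / x] over [x > 0], and
   [F_Z - F_Y] is nonnegative, continuous and not identically zero.  At the endpoints of the domain, where [nu] need not be
   differentiable, monotonicity follows from continuity. *)

(** The obstacle is that [spow q (x - v)] has a derivative in [v] of size |x - v|^(q-2), which is
    unbounded at x = v when q < 2. It is integrable against [f] because q stays above 1 near an
    interior point p, and because [nu p] lies strictly inside the support, where continuity bounds
    [f] locally. An exact identity replaces the implicit function theorem: it asks only for the
    limits of two difference quotients along the curve q -> nu q, not for a jointly differentiable
    M. The price is that [nu] must be known to be continuous at p beforehand; this comes from the
    monotonicity of M in v and its continuity in q. The logarithm produced by differentiating in the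
    exponent is absorbed by moving the exponent a little up and down, and an interior p leaves room
    for that on both sides. *)

Local Notation lintegrable g := (lebesgue_measure.-integrable setT (EFin \o g)).

(** * Lebesgue integration *)

Lemma measurable_fun_reflection (R : realType) (c : R) :
  measurable_fun [set: measurableTypeR R]
    ((fun x => c - x) : measurableTypeR R -> measurableTypeR R).
Proof. by apply: measurable_funB; [exact: measurable_cst|exact: measurable_id]. Qed.

Lemma lebesgue_measure_reflection (R : realType) (c : R) (A : set R) : measurable A ->
  lebesgue_measure A = lebesgue_measure ((fun x => c - x) @^-1` A).
Proof.
move=> mA.
pose phi : measurableTypeR R -> measurableTypeR R := fun x => c - x.
have mphi : measurable_fun setT phi by exact: measurable_fun_reflection.
pose nu := measure_function_pushforward__canonical__measure_function_Measure
  (@lebesgue_measure R) mphi.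
change (lebesgue_measure A = nu A); apply: lebesgue_measure_unique mA => //.
move=> _ [[a b] _ <-] /=; rewrite /pushforward.
rewrite (_ : phi @^-1` _ = `[c - b, c - a[%classic); last first.
  by apply/seteqP; split => x; rewrite /phi /= !in_itv/= => /andP[h1 h2]; apply/andP; split; lra.
rewrite !lebesgue_measure_itv/= !lte_fin ltrD2l ltrN2.
by case: ifP => // _; rewrite -!EFinB; congr EFin; lra.
Qed.

(** A limit at a real parameter can be tested along sequences, and dropping the first [N] terms puts
    all the others in the ball where the bound holds. The null point [c] leaves room for integrands
    that are singular, or fail to converge, at one point. Integrability of each [k q] is the same
    theorem for a constant sequence. *)
Lemma cvg_Rintegral_dominated (R : realType) (k : R -> R -> R) (b : R -> R) (p c r : R) :
  0 < r ->
  (forall q, `|q - p| < r -> measurable_fun setT (k q)) ->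
  (@lebesgue_measure R).-integrable setT (EFin \o b) ->
  (forall q x, `|q - p| < r -> x != c -> `|k q x| <= b x) ->
  (forall x, x != c -> k q x @[q --> p] --> k p x) ->
  (forall q, `|q - p| < r -> (@lebesgue_measure R).-integrable setT (EFin \o k q)) /\
  \int[@lebesgue_measure R]_x k q x @[q --> p] --> \int[@lebesgue_measure R]_x k p x.
Proof.
move=> r0 mk ib kb kp.
have aec (P : R -> Prop) : (forall x, x != c -> P x) ->
    {ae (@lebesgue_measure R), forall x, P x}.
  move=> Pc; exists [set c]; split => //=; first exact: lebesgue_measure_set1.
  by move=> x /= nPx; apply/eqP/negPn; apply/negP => /Pc.
have ik q : `|q - p| < r -> (@lebesgue_measure R).-integrable setT (EFin \o k q).
  move=> qp; have := @dominated_convergence _ _ _ (@lebesgue_measure R) setT measurableT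
    (fun=> EFin \o k q) (EFin \o k q) (EFin \o b).
  case => //.
  - by move=> n; apply/measurable_EFinP; exact: mk.
  - by apply/measurable_EFinP; exact: mk.
  - by apply: aec => x _ _; exact: cvg_cst.
  - by apply: aec => x xc n _ /=; rewrite lee_fin; exact: kb.
split => //.
apply/(@cvg_nbhsP _ R^o) => u up.
have [N _ HN] : \forall n \near \oo, `|u n - p| < r.
  by move/cvgrPdist_lt : (up) => /(_ _ r0); apply: filterS => n; rewrite distrC.
rewrite -(cvg_shiftn N).
have uN n : `|u (n + N)%N - p| < r by apply: HN => /=; exact: leq_addl.
have := @dominated_convergence _ _ _ (@lebesgue_measure R) setT measurableT
    (fun n => EFin \o k (u (n + N)%N)) (EFin \o k p) (EFin \o b).
have pp : `|p - p| < r by rewrite subrr normr0.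
case => //.
- by move=> n; apply/measurable_EFinP; exact: mk.
- by apply/measurable_EFinP; exact: mk.
- apply: aec => x xc _ /=; apply: cvg_EFin; first by apply: nearW.
  move/(@cvg_nbhsP _ R^o) : (kp _ xc) => /(_ u up); rewrite -(cvg_shiftn N).
  exact.
- by apply: aec => x xc n _ /=; rewrite lee_fin; exact: kb.
move=> _ _; have kpf := integrable_fin_num measurableT (ik _ pp).
rewrite -(fineK kpf) => /fine_cvgP[_].
exact.
Qed.

Lemma integral_reflection (R : realType) (c : R) (g : R -> \bar R) :
  measurable_fun setT g ->
  (\int[lebesgue_measure]_x g (c - x)%R = \int[lebesgue_measure]_x g x)%E.
Proof.
have ge0_reflection (h : R -> \bar R) : measurable_fun setT h -> (forall x, 0 <= h x)%E ->
    (\int[lebesgue_measure]_x h (c - x)%R = \int[lebesgue_measure]_x h x)%E.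
  move=> mh h0; have mphi := measurable_fun_reflection c.
  have := @ge0_integral_pushforward _ _ _ _ _ _ mphi (@lebesgue_measure R) setT h
    measurableT mh (fun x _ => h0 x).
  rewrite preimage_setT /comp => <-; apply: eq_measure_integral => A mA _.
  exact/esym/lebesgue_measure_reflection.
move=> mg; rewrite integralE [RHS]integralE.
congr (_ - _)%E.
- rewrite -(ge0_reflection g^\+%E)//; last exact: measurable_funepos.
  by apply: eq_integral => x _; rewrite -[RHS]/((g^\+ \o (fun x => c - x)%R) x)%E -funepos_comp.
- rewrite -(ge0_reflection g^\-%E)//; last exact: measurable_funeneg.
  by apply: eq_integral => x _; rewrite -[RHS]/((g^\- \o (fun x => c - x)%R) x)%E -funeneg_comp.
Qed.

Lemma integral_translation (R : realType) (c : R) (g : R -> \bar R) :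
  measurable_fun setT g ->
  (\int[lebesgue_measure]_x g (c + x)%R = \int[lebesgue_measure]_x g x)%E.
Proof.
move=> mg; rewrite -(integral_reflection c mg) -(integral_reflection 0); last first.
  by apply: (measurableT_comp mg); apply: measurable_funD.
by apply: eq_integral => x _; rewrite sub0r.
Qed.

Lemma integrable_reflection (R : realType) (c : R) (g : R -> R) :
  (@lebesgue_measure R).-integrable setT (EFin \o g) ->
  (@lebesgue_measure R).-integrable setT (fun x => (g (c - x))%:E).
Proof.
move=> /integrableP[mg ig]; apply/integrableP; split.
  by apply: (measurableT_comp mg); apply: measurable_funB.
have := @integral_reflection _ c (fun x => `|(g x)%:E|%E).
by move=> -> //; exact: (measurableT_comp _ mg).
Qed.

Lemma integrable_translation (R : realType) (c : R) (g : R -> R) :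
  (@lebesgue_measure R).-integrable setT (EFin \o g) ->
  (@lebesgue_measure R).-integrable setT (fun x => (g (x - c))%:E).
Proof.
move=> /(integrable_reflection 0) /(integrable_reflection c).
by apply: eq_integrable => //= x _; rewrite sub0r opprB.
Qed.

Lemma measurable_fun_boolr d (T : measurableType d) (R : realType) (P : T -> bool) :
  measurable_fun setT P -> measurable_fun setT (fun x => (P x)%:R : R).
Proof.
move=> mP; apply: (eq_measurable_fun (fun x => if P x then 1 else 0 : R)).
  by move=> x _; case: (P x).
by apply: measurable_fun_ifT.
Qed.

(** The antiderivative x^(a+1) / (a+1) bounds the integral over [1/(n+2), 1] by 1/(a+1), uniformly
    in n; monotone convergence then reaches 0, and a reflection adds the negative half. *)
Lemma integrable_powR_near0 (R : realType) (a : R) : -1 < a ->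
  (@lebesgue_measure R).-integrable setT
    (EFin \o (fun x : R => `|x| `^ a * (0 < `|x| < 1)%R%:R)).
Proof.
move=> a1.
have mpow : measurable_fun [set: R] (fun x : R => x `^ a) by exact: measurable_powR.
(* The shift by two keeps the left end strictly below 1 already for n = 0, as the fundamental
   theorem of calculus requires. *)
pose F n : set R := `[n.+2%:R^-1, 1]%classic.
have Fint n : (\int[lebesgue_measure]_(x in F n) (x `^ a)%:E <= ((a + 1)^-1)%:E)%E.
  have n2 : 0 < n.+2%:R^-1 :> R by rewrite invr_gt0.
  have dG (x : R) : 0 < x -> is_derive x (1:R) (fun x : R => (a + 1)^-1 * x `^ (a + 1)) (x `^ a).
    move=> x0; have -> : x `^ a = (a + 1)^-1 * ((a + 1) * x `^ (a + 1 - 1)).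
      by rewrite mulKf ?addrK//; lra.
    have := is_derive1_powR (a + 1) x0 => d.
    by apply: is_deriveZ.
  have cG (x : R) : 0 < x -> {for x, continuous (fun x : R => (a + 1)^-1 * x `^ (a + 1))}.
    by move=> /dG [d _]; apply: differentiable_continuous; exact/derivable1_diffP.
  rewrite (@continuous_FTC2 _ _ (fun x : R => (a + 1)^-1 * x `^ (a + 1))).
  - rewrite -EFinB lee_fin powR1 mulr1 gerBl// mulr_ge0 ?powR_ge0// invr_ge0; lra.
  - by rewrite invf_lt1 ?ltr1n.
  - apply: continuous_in_subspaceT => x /[!inE]/= /[!in_itv]/= /andP[nx _].
    have x0 := lt_le_trans n2 nx.
    by have [d _] := is_derive1_powR a x0; apply: differentiable_continuous; exact/derivable1_diffP.
  - split.
    + by move=> x; rewrite in_itv/= => /andP[nx _]; have [] := dG x (lt_trans n2 nx).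
    + by apply: cvg_at_right_filter; exact: cG.
    + by apply: cvg_at_left_filter; exact: cG.
  - move=> x; rewrite in_itv/= => /andP[nx _]; rewrite derive1E.
    by have [_ ->] := dG x (lt_trans n2 nx).
have ih : (@lebesgue_measure R).-integrable setT
    (EFin \o (fun x : R => x `^ a * (0 < x < 1)%R%:R)).
  have mh : measurable_fun setT (EFin \o (fun x : R => x `^ a * (0 < x < 1)%R%:R)).
    apply/measurable_EFinP; apply: measurable_funM => //.
    by apply: measurable_fun_boolr; apply: measurable_and; exact: measurable_fun_ltr.
  apply/integrableP; split => //.
  have ndF : nondecreasing_seq F.
    move=> m n mn; apply/subsetPset => x /=; rewrite /F /= !in_itv/= => /andP[+ ->].
    rewrite andbT; apply: le_trans; rewrite lef_pV2 ?posrE// ler_nat.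
    by rewrite !ltnS.
  have mpowE : measurable_fun setT (fun x : R => (x `^ a)%:E) by exact/measurable_EFinP.
  have cvF := @ge0_nondecreasing_set_cvg_integral _ (measurableTypeR R) _ F (fun x => (x `^ a)%:E)
    (@lebesgue_measure R) ndF (fun=> measurable_itv _)
    (fun=> measurable_funTS mpowE) (fun _ x _ => powR_ge0 x a).
  apply: (@le_lt_trans _ _ (\int[lebesgue_measure]_(x in \bigcup_i F i) (x `^ a)%:E)%E).
    rewrite [leRHS]integral_mkcond; apply: ge0_le_integral => //.
    - exact: measurableT_comp.
    - apply/(measurable_restrictT _ _).1; last exact: measurable_funTS.
      by apply: bigcup_measurable => n _; exact: measurable_itv.
    - move=> x _ /=; rewrite patchE.
      have [x01|_] := boolP (0 < x < 1); last first.
        rewrite mulr0 normr0; case: ifPn => // _; rewrite lee_fin; exact: powR_ge0.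
      rewrite mulr1 ger0_norm ?powR_ge0// mem_set//=.
      have /andP[x0 x1] := x01.
      exists (Num.truncn x^-1) => //; rewrite /F /= in_itv/= (ltW x1) andbT.
      rewrite invf_ple ?posrE// ltW// (lt_trans (truncnS_gt _))// ltr_nat.
      by [].
  apply: (@le_lt_trans _ _ ((a + 1)^-1)%:E); last exact: ltry.
  rewrite -(cvg_lim _ cvF)//.
  by apply: lime_le; [apply/cvg_ex; eexists; exact: cvF|exact: nearW].
have := integrable_reflection 0 ih => ih'.
have := integrableD measurableT ih ih'.
apply: eq_integrable => // x _ /=; rewrite -EFinD; congr EFin.
rewrite sub0r.
have [x0|x0|->] := ltgtP x 0.
- by rewrite ltr0_norm// ?oppr_gt0 ?x0/= mulr0 add0r.
- by rewrite gtr0_norm// oppr_gt0 ?(lt_gtF x0) ?x0/= mulr0 addr0.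
- by rewrite normr0 oppr0 ltxx !mulr0 addr0.
Qed.

(** * Odd powers and their difference quotients *)

(** A difference of two [ppow], so that the two sides of [is_pmean] are the integrals of its
    positive and negative parts. Its value at 0 is 0 even for q = 1. *)
Definition spow (R : realType) (q u : R) : R := ppow u q - ppow (- u) q.

Lemma ppow_ge0 (R : realType) (a q : R) : 0 <= ppow a q.
Proof. by rewrite /ppow; case: ifP => // _; exact: powR_ge0. Qed.

Lemma measurable_ppow (R : realType) (q : R) : measurable_fun setT (fun a => ppow a q).
Proof.
by apply: measurable_fun_ifT => //; exact: measurable_fun_ltr.
Qed.

Lemma measurable_spow (R : realType) (q : R) : measurable_fun setT (spow q).
Proof.
apply: measurable_funB; first exact: measurable_ppow.
by apply: (measurableT_comp (measurable_ppow q)).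
Qed.

Lemma spowN (R : realType) (q u : R) : spow q (- u) = - spow q u.
Proof. by rewrite /spow opprK opprB. Qed.

Lemma spow_gt0E (R : realType) (q u : R) : 0 < u -> spow q u = u `^ (q - 1).
Proof. by move=> u0; rewrite /spow /ppow u0 oppr_gt0 (lt_gtF u0) subr0. Qed.

Lemma spow0 (R : realType) (q : R) : spow q 0 = 0.
Proof. by rewrite /spow oppr0 subrr. Qed.

Lemma spow_ge0E (R : realType) (q u : R) : 1 < q -> 0 <= u -> spow q u = u `^ (q - 1).
Proof.
move=> q1; rewrite le_eqVlt => /predU1P[<-|]; last exact: spow_gt0E.
by rewrite spow0 powR0//; lra.
Qed.

(** The 1 covers u <= 1 and the larger exponent covers u >= 1. This is how a single moment of order
    Q - 1 dominates all lower ones uniformly. *)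
Lemma powR_le1D (R : realType) (u s t : R) : 0 <= u -> 0 <= s <= t -> u `^ s <= 1 + u `^ t.
Proof.
move=> u0 /andP[s0 st]; have [u1|/ltW u1] := lerP 1 u.
  by rewrite (le_trans (ler_powR u1 st))// lerDr.
rewrite (@le_trans _ _ 1)// ?lerDl ?powR_ge0//.
by have := ge0_ler_powR s0; move/(_ u 1); rewrite powR1 !nnegrE; apply.
Qed.

Lemma norm_spow_le (R : realType) (q Q u : R) : 1 <= q <= Q ->
  `|spow q u| <= 1 + `|u| `^ (Q - 1).
Proof.
move=> qQ; wlog u0 : u / 0 <= u => [hw|].
  have [/hw//|/ltW] := lerP 0 u; rewrite -oppr_ge0 => /hw.
  by rewrite spowN !normrN.
move: u0; rewrite le_eqVlt => /predU1P[<-|u0].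
  by rewrite spow0 normr0 addr_ge0// powR_ge0.
rewrite spow_gt0E// ger0_norm ?powR_ge0// gtr0_norm//.
by apply: powR_le1D; [exact: ltW|lra].
Qed.

Lemma le_spow (R : realType) (q u v : R) : 1 <= q -> u <= v -> spow q u <= spow q v.
Proof.
move=> q1; have mono (a b : R) : a <= b -> ppow a q <= ppow b q.
  move=> ab; rewrite /ppow; case: ifPn => a0; last by case: ifP => // _; exact: powR_ge0.
  rewrite (lt_le_trans a0 ab); apply: ge0_ler_powR => //; rewrite ?nnegrE; lra.
by move=> uv; apply: lerB; apply: mono => //; rewrite lerN2.
Qed.

(** For q = 1 the function is the sign, so strictness can be expected only across 0. *)
Lemma lt_spow (R : realType) (q u v : R) : u < 0 -> 0 < v -> spow q u < spow q v.
Proof.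
move=> u0 v0; rewrite -(opprK u) spowN !spow_gt0E ?oppr_gt0//.
by rewrite (@lt_trans _ _ 0) ?oppr_lt0 ?powR_gt0 ?oppr_gt0.
Qed.

Lemma spow_cvg (R : realType) (u : R) (p : R) : spow q u @[q --> p] --> spow p u.
Proof.
have cont (v : R) : ppow v q @[q --> p] --> ppow v p.
  rewrite /ppow; case: ifPn => v0; last exact: cvg_cst.
  rewrite /powR gt_eqF//.
  apply: (cvg_comp (fun q => (q - 1) * ln v) (@expR R)); last exact: continuous_expR.
  by apply: cvgMl; apply: cvgB => //; exact: cvg_cst.
by apply: cvgB.
Qed.

Lemma MVT_norm (R : realType) (F F' : R -> R) (a b : R) :
  (forall x, `|x - a| <= `|b - a| -> is_derive x (1 : R) F (F' x)) ->
  exists2 c, `|c - a| <= `|b - a| & F b - F a = F' c * (b - a).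
Proof.
move=> dF.
have cF x : `|x - a| <= `|b - a| -> {for x, continuous F}.
  by move=> /dF [d _]; apply: differentiable_continuous; exact/derivable1_diffP.
have [ab|ba|->] := ltgtP a b.
- have [||c] := @MVT _ F F' a b ab.
  + move=> x; rewrite in_itv/= => /andP[h1 h2]; apply: dF.
    by rewrite !gtr0_norm ?subr_gt0// lerB// ltW.
  + apply: continuous_in_subspaceT => x /[!inE]/= /[!in_itv]/= /andP[h1 h2]; apply: cF.
    by rewrite !ger0_norm ?subr_ge0 ?lerB// ltW.
  rewrite in_itv/= => /andP[h1 h2] E; exists c => //.
  by rewrite !gtr0_norm ?subr_gt0// lerB// ltW.
- have [||c] := @MVT _ F F' b a ba.
  + move=> x; rewrite in_itv/= => /andP[h1 h2]; apply: dF.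
    by rewrite !ltr0_norm ?subr_lt0// !opprB lerB// ltW.
  + apply: continuous_in_subspaceT => x /[!inE]/= /[!in_itv]/= /andP[h1 h2]; apply: cF.
    by rewrite !ler0_norm ?subr_le0 ?opprB ?lerB// ltW.
  rewrite in_itv/= => /andP[h1 h2] E; exists c => //.
    by rewrite !ltr0_norm ?subr_lt0// !opprB lerB// ltW.
  by rewrite -(opprB a b) mulrN -E opprB.
- by exists b; rewrite ?subrr ?normr0 ?mulr0.
Qed.

(* The bound 2 |u|^(q-2) does not involve v: this is what dominates the
   difference quotients although the derivative is singular at 0. *)
Lemma spow_lipschitz_le2 (R : realType) (q u v : R) : 1 < q <= 2 -> u != 0 ->
  `|spow q u - spow q v| <= 2 * `|u - v| * `|u| `^ (q - 2).
Proof.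
move=> q12; wlog u0 : u v / 0 < u => [hw u_neq0|_].
  have [/hw/(_ u_neq0)//|u0] := ltP 0 u.
  have := hw (- u) (- v); rewrite oppr_gt0 oppr_eq0 lt_neqAle u_neq0 u0 => /(_ isT isT).
  by rewrite !spowN -!opprD !normrN.
(* By homogeneity, with w = v / u, it is enough to bound |1 - spow q w| by 2 |1 - w|. *)
have scale w : spow q (u * w) = u `^ (q - 1) * spow q w.
  have [w0|w0|->] := ltgtP w 0.
  - have -> : u * w = - (u * - w) by ring.
    have -> : spow q w = - spow q (- w) by rewrite spowN opprK.
    rewrite spowN !spow_gt0E ?mulr_gt0 ?oppr_gt0//.
    by rewrite powRM ?(ltW u0) ?oppr_ge0 ?(ltW w0)// mulrN.
  - by rewrite !spow_gt0E ?mulr_gt0// powRM// ltW.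
  - by rewrite mulr0 spow0 mulr0.
pose w := v / u.
have -> : v = u * w by rewrite /w mulrC divfK ?gt_eqF.
have -> : u - u * w = u * (1 - w) by ring.
rewrite -[in spow q u](mulr1 u) !scale -mulrBr !normrM (ger0_norm (powR_ge0 _ _)).
rewrite (gtr0_norm u0).
have -> : u `^ (q - 1) = u * u `^ (q - 2).
  by rewrite -{2}(powRr1 (ltW u0)) -powRD ?(gt_eqF u0) ?implybT//; congr powR; lra.
rewrite [leRHS](_ : _ = u * u `^ (q - 2) * (2 * `|1 - w|)); last by ring.
apply: ler_wpM2l; first by rewrite mulr_ge0 ?powR_ge0// ltW.
rewrite spow_gt0E// powR1.
(* For w >= 0 the power w^(q-1) lies between 1 and w, since 0 < q - 1 <= 1. A negative w is what
   costs the factor 2: 1 + |w|^(q-1) <= 2 + |w| <= 2 (1 + |w|). *)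
have [w0|w0] := leP 0 w.
  rewrite (spow_ge0E _ w0); last by lra.
  move: w0; rewrite le_eqVlt => /predU1P[<-|w0].
    by rewrite powR0 ?subr0 ?normr1; [lra|lra].
  have [w1|w1] := leP w 1.
    have : w <= w `^ (q - 1) by apply: ger1_powR; [rewrite w0 w1|lra].
    have : w `^ (q - 1) <= 1.
      have s0 : 0 <= q - 1 by lra.
      by have /(_ w 1) := ge0_ler_powR s0; rewrite powR1 !nnegrE; apply; lra.
    by move=> h1 h2; rewrite !ger0_norm; lra.
  have : w `^ (q - 1) <= w by apply: ler1_powR; lra.
  have : 1 <= w `^ (q - 1) by have := @ler_powR _ w (ltW w1) 0 (q - 1); rewrite powRr0; apply; lra.
  by move=> h1 h2; rewrite !ler0_norm; lra.
rewrite -(opprK w) spowN spow_gt0E ?oppr_gt0//.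
have : (- w) `^ (q - 1) <= 1 + (- w) `^ 1 by apply: powR_le1D; lra.
rewrite powRr1; last lra.
have := powR_ge0 (- w) (q - 1) => h1 h2.
by rewrite !ger0_norm; lra.
Qed.

(** Now the derivative (q-1) |x|^(q-2) grows with |x|, so the mean value theorem settles arguments
    of the same sign. Across 0, a * a^(q-2) + b * b^(q-2) <= (a + b) * (a + b)^(q-2), and 1 <= q -
    1. *)
Lemma spow_lipschitz_ge2 (R : realType) (q u v : R) : 2 <= q ->
  `|spow q u - spow q v| <= (q - 1) * `|u - v| * (`|u| + `|v|) `^ (q - 2).
Proof.
move=> q2.
have mono (a b : R) : 0 <= a -> a <= b -> a `^ (q - 2) <= b `^ (q - 2).
  by move=> a0 ab; apply: ge0_ler_powR => //; rewrite ?nnegrE; lra.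
have splitp (a : R) : 0 < a -> a `^ (q - 1) = a * a `^ (q - 2).
  move=> a0; rewrite -{2}(powRr1 (ltW a0)) -powRD ?(gt_eqF a0) ?implybT//.
  by congr powR; lra.
have pos (a b : R) : 0 < a -> 0 < b ->
    `|spow q a - spow q b| <= (q - 1) * `|a - b| * (a + b) `^ (q - 2).
  wlog ab : a b / a <= b => [hw a0 b0|a0 b0].
    case/orP: (le_total a b) => /hw; first by apply.
    by rewrite distrC (distrC a) (addrC a); apply.
  have [||c] := @MVT_segment _ (fun x : R => x `^ (q - 1))
    (fun x => (q - 1) * x `^ (q - 1 - 1)) a b ab.
  - move=> x; rewrite in_itv/= => /andP[h1 h2]; apply: is_derive1_powR.
    exact: lt_trans h1.
  - apply: continuous_in_subspaceT => x /[!inE]/= /[!in_itv]/= /andP[h1 h2].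
    have [d _] := is_derive1_powR (q - 1) (lt_le_trans a0 h1).
    by apply: differentiable_continuous; exact/derivable1_diffP.
  rewrite in_itv/= => /andP[h1 h2] E.
  rewrite distrC (distrC a) !spow_gt0E// E !normrM (ger0_norm (powR_ge0 _ _)).
  rewrite (ger0_norm (_ : 0 <= q - 1)); last lra.
  rewrite -!mulrA ler_wpM2l//; first lra.
  rewrite mulrC ler_wpM2l// (_ : q - 1 - 1 = q - 2); last by lra.
  by apply: mono; lra.
have zero (a : R) : 0 < a ->
    `|spow q a| <= (q - 1) * `|a| * `|a| `^ (q - 2).
  move=> a0; rewrite spow_gt0E// ger0_norm ?powR_ge0// gtr0_norm// splitp//.
  by rewrite -mulrA ler_peMl ?mulr_ge0 ?powR_ge0 ?(ltW a0)//; lra.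
have opp (a b : R) : 0 < a -> 0 < b ->
    `|spow q a + spow q b| <= (q - 1) * `|a + b| * (a + b) `^ (q - 2).
  move=> a0 b0; have ab0 : 0 <= a + b by lra.
  rewrite !spow_gt0E// ger0_norm ?addr_ge0 ?powR_ge0// (ger0_norm ab0).
  rewrite !splitp//; apply: (@le_trans _ _ ((a + b) * (a + b) `^ (q - 2))).
    by rewrite mulrDl lerD// ler_wpM2l ?(ltW a0) ?(ltW b0)// mono; lra.
  by rewrite -mulrA ler_peMl ?mulr_ge0 ?powR_ge0//; lra.
wlog u0 : u v / 0 <= u => [hw|].
  have [/hw//|/ltW] := lerP 0 u; rewrite -oppr_ge0 => /(hw _ (- v)).
  by rewrite !spowN -!opprD !normrN.
move: u0; rewrite le_eqVlt => /predU1P[<-|u0].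
  rewrite spow0 !sub0r !normrN normr0 add0r.
  have [v0|v0|->] := ltgtP v 0.
  - by have := zero (- v); rewrite oppr_gt0 spowN !normrN; exact.
  - exact: zero.
  - by rewrite spow0 !normr0 mulr0 mul0r.
rewrite (gtr0_norm u0).
have [v0|v0|->] := ltgtP v 0.
- rewrite (ltr0_norm v0); have := opp u (- v) u0; rewrite oppr_gt0 => /(_ v0).
  by rewrite spowN.
- by rewrite (gtr0_norm v0); exact: pos.
- by rewrite spow0 !subr0 normr0 addr0; have := zero _ u0; rewrite (gtr0_norm u0).
Qed.

(** Completed at h = 0 by the derivative: the step will be [nu q - nu p], which may vanish for q
    arbitrarily close to p. *)
Definition spow_slope (R : realType) (q u h : R) : R :=
  if h == 0 then (q - 1) * `|u| `^ (q - 2) else (spow q u - spow q (u - h)) / h.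

(* Dominates the difference quotients of [spow q] at [u] for steps [|h| <= 1] and
   exponents [q0 <= q <= Q], uniformly. *)
Definition slope_bound (R : realType) (q0 Q u : R) : R :=
  2 * (`|u| `^ (q0 - 2) * (0 < `|u| < 1)%R%:R) + 2 +
  Q * (1 + (2 * `|u| + 1) `^ (Q - 1)).

(** For q <= 2 the bound 2 |u|^(q-2) is worst at the exponent q0 when |u| < 1 and is at most 2
    otherwise. For q >= 2 the step |h| <= 1 gives |u| + |u - h| <= 2 |u| + 1, the base of the last
    term. *)
Lemma norm_spow_slope_le (R : realType) (q0 Q q u h : R) :
  1 < q0 -> q0 <= q <= Q -> `|h| <= 1 -> u != 0 ->
  `|spow_slope q u h| <= slope_bound q0 Q u.
Proof.
move=> q01 q0qQ h1 u0; rewrite /slope_bound.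
have nu0 : 0 < `|u| by rewrite normr_gt0.
have bnd2 : q <= 2 -> 2 * `|u| `^ (q - 2) <=
    2 * (`|u| `^ (q0 - 2) * (0 < `|u| < 1)%R%:R) + 2.
  move=> q2; rewrite nu0/=; have [u1|u1] := ltP `|u| 1.
    rewrite mulr1 (@le_trans _ _ (2 * `|u| `^ (q0 - 2))) ?lerDl// ler_wpM2l//.
    by apply: ger_powR; [rewrite nu0 ltW|lra].
  rewrite mulr0 mulr0 add0r -{3}(mulr1 2) ler_wpM2l// -{2}(powRr0 `|u|).
  by apply: ler_powR => //; lra.
have A0 : 0 <= 2 * (`|u| `^ (q0 - 2) * (0 < `|u| < 1)%R%:R).
  by rewrite !mulr_ge0 ?powR_ge0.
have B0 : 0 <= Q * (1 + (2 * `|u| + 1) `^ (Q - 1)).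
  by rewrite mulr_ge0 ?addr_ge0 ?powR_ge0//; lra.
have bnd3 : 2 <= q -> forall w, 0 <= w <= 2 * `|u| + 1 ->
    (q - 1) * w `^ (q - 2) <= Q * (1 + (2 * `|u| + 1) `^ (Q - 1)).
  move=> q2 w /andP[w0 w1]; apply: ler_pM; rewrite ?powR_ge0//; [lra|lra|].
  rewrite (@le_trans _ _ ((2 * `|u| + 1) `^ (q - 2)))//; last first.
    by apply: powR_le1D; lra.
  by apply: ge0_ler_powR => //; rewrite ?nnegrE; lra.
rewrite /spow_slope; case: eqVneq => [_|hn0].
  have q10 : 0 <= q - 1 by lra.
  rewrite normrM (ger0_norm (powR_ge0 _ _)) (ger0_norm q10).
  have [q2|/ltW q2] := leP q 2.
    have := bnd2 q2; have := powR_ge0 `|u| (q - 2) => p0 b2.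
    have : (q - 1) * `|u| `^ (q - 2) <= 2 * `|u| `^ (q - 2) by apply: ler_wpM2r => //; lra.
    lra.
  by have : (q - 1) * `|u| `^ (q - 2) <= Q * (1 + (2 * `|u| + 1) `^ (Q - 1)); [apply: bnd3; lra|lra].
have nh0 : 0 < `|h| by rewrite normr_gt0.
rewrite normrM normfV ler_pdivrMr//.
have uh : u - (u - h) = h by ring.
have [q2|/ltW q2] := leP q 2.
  have q12 : 1 < q <= 2 by lra.
  have := spow_lipschitz_le2 (u - h) q12 u0; rewrite uh => /le_trans; apply.
  rewrite [leLHS](_ : _ = 2 * `|u| `^ (q - 2) * `|h|); last by ring.
  by rewrite ler_pM2r//; have := bnd2 q2; lra.
have := spow_lipschitz_ge2 u (u - h) q2; rewrite uh => /le_trans; apply.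
rewrite [leLHS](_ : _ = (q - 1) * (`|u| + `|u - h|) `^ (q - 2) * `|h|); last by ring.
rewrite ler_pM2r//.
have : `|u - h| <= `|u| + `|h| by exact: ler_normB.
have := normr_ge0 (u - h) => n1 n2.
have := bnd3 q2 (`|u| + `|u - h|) => b3.
have : 0 <= `|u| + `|u - h| <= 2 * `|u| + 1 by lra.
by move=> /b3; lra.
Qed.

Lemma spow_slopeN (R : realType) (q u h : R) :
  spow_slope q (- u) h = spow_slope q u (- h).
Proof.
rewrite /spow_slope oppr_eq0 normrN; case: eqP => // _.
by rewrite -opprD !spowN !opprK invrN mulrN -mulNr; congr (_ / _); ring.
Qed.

(** Exponent and step move together, so the derivative (q-1) u^(q-2) has to be continuous jointly in
    (q, u). The mean value theorem replaces the quotient by this derivative at a point within |h q|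
    of u, and |h q| < u keeps that point positive. *)
Lemma spow_slope_cvg (R : realType) (p u : R) (h : R -> R) : u != 0 ->
  h p = 0 -> h q @[q --> p] --> (0 : R) ->
  spow_slope q u (h q) @[q --> p] --> spow_slope p u (h p).
Proof.
wlog u0 : u h / 0 < u => [hw un0 hp0 hp|_ hp0 hp].
  have [u0|u0] := ltP 0 u; first exact: hw.
  have := hw (- u) (\- h); rewrite /= oppr_gt0 oppr_eq0 lt_neqAle un0 u0 hp0 oppr0.
  have -> : (fun q => spow_slope q (- u) (- h q)) = (fun q => spow_slope q u (h q)).
    by apply/funext => q; rewrite spow_slopeN opprK.
  rewrite spow_slopeN oppr0; apply => //.
  by rewrite -oppr0; exact: cvgN.
have joint : (z.1 - 1) * z.2 `^ (z.1 - 2) @[z --> (p, u)] --> (p - 1) * u `^ (p - 2).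
  have c1 : z.1 @[z --> (p, u)] --> p by exact: cvg_fst.
  have c2 : z.2 @[z --> (p, u)] --> u by exact: cvg_snd.
  apply: cvgM; first by apply: cvgB => //; exact: cvg_cst.
  rewrite {2}/powR gt_eqF//.
  have pos : \forall z \near (p, u), 0 < z.2.
    exact: (cvgr_gt u c2 0 u0).
  have ce : expR ((z.1 - 2) * ln z.2) @[z --> (p, u)] --> expR ((p - 2) * ln u).
    apply: (cvg_comp (fun z : R * R => (z.1 - 2) * ln z.2) (@expR R)); last exact: continuous_expR.
    apply: cvgM; first by apply: cvgB; [exact: c1|exact: cvg_cst].
    by apply: (cvg_comp _ _ c2); exact: continuous_ln.
  apply: cvg_trans ce; apply: near_eq_cvg; apply: filterS pos => z z0 /=.
  by rewrite /powR gt_eqF.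
rewrite {2}/spow_slope hp0 eqxx (gtr0_norm u0).
apply/cvgrPdist_lt => e e0.
move/cvgrPdist_lt : joint => /(_ e e0) [[A B] /= [Ap Bu] AB].
have [d /= d0 dB] : exists2 d, 0 < d & forall x, `|x - u| < d -> B x.
  move: Bu => /nbhs_ballP[d /= d0 dB]; exists d => // x xu; apply: dB.
  by rewrite /ball /= distrC.
have hsmall : \forall q \near p, `|h q| < Num.min d u.
  move/cvgrPdist_lt : hp => /(_ (Num.min d u)); rewrite lt_min d0 u0 => /(_ isT).
  by apply: filterS => q; rewrite sub0r normrN.
near=> q.
have hq : `|h q| < Num.min d u by near: q.
have Aq : A q by near: q.
have [hd hu] : `|h q| < d /\ `|h q| < u by move: hq; rewrite lt_min => /andP.
rewrite /spow_slope; case: eqVneq => [_|hn0].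
  have := AB (q, u); rewrite /= (gtr0_norm u0); apply; split => //=.
  by apply: dB; rewrite subrr normr0.
have [c cu E] : exists2 c, `|c - u| <= `|h q| &
    spow q u - spow q (u - h q) = (q - 1) * c `^ (q - 2) * h q.
  have [|c] := @MVT_norm _ (fun x => x `^ (q - 1)) (fun x => (q - 1) * x `^ (q - 1 - 1)) u (u - h q).
    move=> x; rewrite addrAC subrr sub0r normrN => xu.
    apply: is_derive1_powR; move: xu; rewrite ler_distl => /andP[]; lra.
  rewrite addrAC subrr sub0r normrN => cu E; exists c => //.
  have uh0 : 0 < u - h q by have := ler_norm (h q); lra.
  rewrite !spow_gt0E// -opprB E mulrN opprK; congr (_ * _ `^ _ * _); lra.
rewrite E mulfK//.
have := AB (q, c); rewrite /=; apply; split => //=.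
by apply: dB; apply: le_lt_trans hd.
Unshelve. all: by end_near.
Qed.

(** Completed at q = p by the derivative in the exponent. At u = 0 the logarithm does no harm, since
    it is multiplied by [spow p 0 = 0]. *)
Definition spow_logslope (R : realType) (p q u : R) : R :=
  if q == p then spow p u * ln `|u| else (spow q u - spow p u) / (q - p).

Lemma spow_logslopeN (R : realType) (p q u : R) :
  spow_logslope p q (- u) = - spow_logslope p q u.
Proof.
rewrite /spow_logslope; case: ifP => _; rewrite !spowN ?normrN ?mulNr//.
by rewrite -opprD mulNr.
Qed.

Lemma spow_logslope_cvg (R : realType) (p u : R) :
  spow_logslope p q u @[q --> p] --> spow_logslope p p u.
Proof.
wlog u0 : u / 0 <= u => [hw|].
  case/orP: (le_total 0 u) => [/hw//|]; rewrite -oppr_ge0 => /hw h.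
  have E q : spow_logslope p q u = - spow_logslope p q (- u).
    by rewrite spow_logslopeN opprK.
  by rewrite E (_ : (fun q => _) = (fun q => - spow_logslope p q (- u))); [exact: cvgN|exact/funext].
move: u0; rewrite le_eqVlt => /predU1P[<-|u0].
  rewrite (_ : (fun q => _) = cst (spow_logslope p p 0)); first exact: cvg_cst.
  apply/funext => q; rewrite /spow_logslope eqxx; case: ifP => // _.
  by rewrite !spow0 subrr mul0r mul0r.
have dF (x : R) : is_derive x (1 : R) (fun q => u `^ (q - 1)) (u `^ (x - 1) * ln u).
  rewrite /powR gt_eqF//.
  have d1 : is_derive x (1 : R) (fun q => (q - 1) * ln u) (ln u).
    have e := is_deriveZ (ln u) (is_deriveB (is_derive_id x (1 : R)) (is_derive_cst (1 : R) x 1)).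
    have -> : (fun q => (q - 1) * ln u) = ln u *: (id - cst 1) :> (R -> R).
      by apply/funext => q; rewrite /= mulrC.
    by move: e; rewrite subr0 /GRing.scale/= mulr1.
  exact: (@is_derive1_comp _ (@expR R) (fun q => (q - 1) * ln u) x _ _ (is_derive_expR _) d1).
have cF : u `^ (q - 1) * ln u @[q --> p] --> u `^ (p - 1) * ln u.
  have E : (fun q => spow q u) = (fun q => u `^ (q - 1)).
    by apply/funext => q; rewrite spow_gt0E.
  by have := @spow_cvg _ u p; rewrite E spow_gt0E// => ?; exact: cvgMl.
rewrite {2}/spow_logslope eqxx spow_gt0E// gtr0_norm//.
apply/cvgrPdist_lt => e e0.
move/cvgrPdist_lt : cF => /(_ e e0) /nbhs_ballP[d /= d0 dB].
apply/nbhs_ballP; exists d => //= q pq.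
rewrite /spow_logslope; case: eqVneq => [_|qp].
  by rewrite spow_gt0E// (gtr0_norm u0) subrr normr0.
have [c cp] := @MVT_norm _ (fun x => u `^ (x - 1)) (fun x => u `^ (x - 1) * ln u) p q (fun x _ => dF x).
rewrite !spow_gt0E// => ->; rewrite mulfK ?subr_eq0//; apply: dB.
by rewrite /ball/= distrC (le_lt_trans cp)// distrC.
Qed.

(** From 1 + t <= exp t at t = c ln u and t = - c ln u one gets c |ln u| <= u^c + u^(-c): the
    logarithm is traded for a shift of the exponent by c in both directions. *)
Lemma norm_ln_powR_le (R : realType) (u a c : R) : 0 < u -> 0 < c ->
  `|ln u| * u `^ a <= c^-1 * (u `^ (a + c) + u `^ (a - c)).
Proof.
move=> u0 c0; rewrite mulrC ler_pdivlMl//.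
have E b : u `^ b = expR (b * ln u) by rewrite /powR gt_eqF.
have -> : u `^ (a + c) = u `^ a * u `^ c by rewrite powRD ?(gt_eqF u0) ?implybT.
have -> : u `^ (a - c) = u `^ a * u `^ (- c) by rewrite powRD ?(gt_eqF u0) ?implybT.
rewrite mulrCA -mulrDr ler_wpM2l ?powR_ge0// !E.
have := expR_ge1Dx (c * ln u); have := expR_ge1Dx (- c * ln u).
have := expR_ge0 (c * ln u); have := expR_ge0 (- c * ln u).
rewrite mulNr => h1 h2 h3 h4.
rewrite -(gtr0_norm c0) -normrM (gtr0_norm c0).
by rewrite ler_norml; apply/andP; split; lra.
Qed.

(** For x <= y, exp y - exp x = exp y * (1 - exp (x - y)) <= exp y * (y - x); adding the other
    exponential makes the bound symmetric. *)
Lemma norm_expRB_le (R : realType) (x y : R) :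
  `|expR x - expR y| <= `|x - y| * (expR x + expR y).
Proof.
wlog xy : x y / x <= y => [hw|].
  case/orP: (le_total x y) => /hw; first by [].
  by rewrite distrC (distrC y) [expR y + _]addrC.
rewrite distrC (distrC x) !ger0_norm ?subr_ge0 ?ler_expR//.
have -> : expR x = expR y * expR (x - y) by rewrite -expRD addrCA subrr addr0.
have := expR_ge1Dx (x - y); have := expR_gt0 (x - y); have := expR_gt0 y => y0 e0 e1.
have h1 : expR y * (1 - expR (x - y)) <= expR y * (y - x) by rewrite ler_pM2l//; lra.
have h2 : 0 <= (y - x) * (expR y * expR (x - y)) by rewrite !mulr_ge0 ?subr_ge0// ltW.
lra.
Qed.

(** The margin c on both sides keeps the shifted exponents p - 1 ± c and q - 1 ± c within
    [0, Q - 1]. Each of the two logarithmic terms then costs 2 / c. *)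
Lemma norm_spow_logslope_le (R : realType) (p q c Q u : R) : 0 < c ->
  1 + c <= p <= Q - c -> 1 + c <= q <= Q - c ->
  `|spow_logslope p q u| <= 4 * c^-1 * (1 + `|u| `^ (Q - 1)).
Proof.
move=> c0 pQ qQ; wlog u0 : u / 0 <= u => [hw|].
  case/orP: (le_total 0 u) => [/hw//|]; rewrite -oppr_ge0 => /hw.
  by rewrite spow_logslopeN !normrN.
have ci : 0 <= c^-1 by rewrite invr_ge0 ltW.
have B0 : 0 <= 1 + `|u| `^ (Q - 1) by rewrite addr_ge0// powR_ge0.
move: u0; rewrite le_eqVlt => /predU1P[u0|u0].
  rewrite (_ : spow_logslope _ _ _ = 0) ?normr0 ?mulr_ge0//.
  by rewrite /spow_logslope -u0 !spow0 subrr !mul0r if_same.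
have bnd (a : R) : 1 + c <= a <= Q - c ->
    `|ln u| * u `^ (a - 1) <= 2 * c^-1 * (1 + `|u| `^ (Q - 1)).
  move=> aQ; apply: le_trans (norm_ln_powR_le _ u0 c0) _.
  rewrite [leRHS](_ : _ = c^-1 * ((1 + `|u| `^ (Q - 1)) + (1 + `|u| `^ (Q - 1)))); last by ring.
  by rewrite ler_wpM2l// (gtr0_norm u0) lerD//; apply: powR_le1D; rewrite ?(ltW u0)//; lra.
rewrite /spow_logslope; case: eqVneq => [_|qp].
  rewrite spow_gt0E// normrM mulrC (gtr0_norm u0) (ger0_norm (powR_ge0 _ _)).
  have := bnd _ pQ; rewrite (gtr0_norm u0) => /le_trans; apply.
  by rewrite -(gtr0_norm u0) -!mulrA ler_wpM2r ?mulr_ge0//; lra.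
rewrite normrM normfV ler_pdivrMr ?normr_gt0 ?subr_eq0//.
rewrite !spow_gt0E//.
have key (a b : R) : `|u `^ (a - 1) - u `^ (b - 1)| <=
    `|a - b| * (`|ln u| * u `^ (a - 1) + `|ln u| * u `^ (b - 1)).
  rewrite /powR gt_eqF// -mulrDr mulrA -normrM.
  have -> : (a - b) * ln u = (a - 1) * ln u - (b - 1) * ln u by ring.
  exact: norm_expRB_le.
have := bnd _ pQ; have := bnd _ qQ => h1 h2.
apply: le_trans (key q p) _; rewrite mulrC ler_wpM2r//; lra.
Qed.

(** * Moments of a density supported by an interval *)

Lemma lintegrable_le (R : realType) (g b : R -> R) :
  measurable_fun setT g -> lintegrable b -> (forall x, `|g x| <= b x) -> lintegrable g.
Proof.
move=> mg ib gb; apply: le_integrable ib => //; first exact/measurable_EFinP.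
by move=> x _ /=; rewrite lee_fin (le_trans (gb x))// ler_norm.
Qed.

Lemma lintegrableD (R : realType) (g h : R -> R) :
  lintegrable g -> lintegrable h -> lintegrable (fun x => g x + h x).
Proof. by move=> ig ih; have := integrableD measurableT ig ih. Qed.

Lemma lintegrableZ (R : realType) (k : R) (g : R -> R) :
  lintegrable g -> lintegrable (fun x => k * g x).
Proof. by move=> ig; have := integrableZl measurableT k ig. Qed.

(** Otherwise [h] would vanish almost everywhere, although it is positive on an interval of length 2
    d. *)
Lemma Rintegral_gt0 (R : realType) (h : R -> R) (y d : R) :
  lintegrable h -> (forall x, 0 <= h x) -> 0 < d ->
  (forall x, `|x - y| < d -> 0 < h x) ->
  0 < \int[lebesgue_measure]_x h x.
Proof.
move=> ih h0 d0 hpos; rewrite lt_def Rintegral_ge0// andbT; apply/eqP => I0.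
have E0 : (\int[lebesgue_measure]_x `|(EFin \o h) x| = 0)%E.
  rewrite -[RHS]/(0%:E) -I0 fineK; last exact: integrable_fin_num.
  by apply: eq_integral => x _ /=; rewrite ger0_norm.
have mh : measurable_fun setT (EFin \o h) by case/integrableP : ih.
have [N [mN N0 sN]] := (ae_eq_integral_abs lebesgue_measure measurableT mh).1 E0.
have : (@lebesgue_measure R [set` `](y - d)%R, (y + d)%R[%R] <= 0)%E.
  rewrite -[leRHS]N0; apply: le_measure; rewrite ?inE//.
  move=> x /=; rewrite in_itv/= => /andP[x1 x2]; apply: sN => /= /(_ I) [hx].
  by have := hpos x; rewrite hx ltxx ltr_distl x1 x2 => /(_ isT).
rewrite lebesgue_measure_itv/= lte_fin ifT; last by lra.
by rewrite -EFinB lee_fin; lra.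
Qed.

(** The support condition is [id_support] together with [id_dense]: {f > 0} is dense in the
    interval, so [f] may have zeros inside it. *)
Record interval_density (R : realType) (f : R -> R) (L Rb : \bar R) : Prop := {
  id_density : is_density f;
  id_support : forall x, ~ (L < x%:E < Rb)%E -> f x = 0;
  id_dense : forall x, (L < x%:E < Rb)%E ->
    forall e : R, 0 < e -> exists y, `|y - x| < e /\ 0 < f y;
  id_continuous : forall x, (L < x%:E < Rb)%E -> {for x, continuous f} }.

Section densities.
Context (R : realType) (f : R -> R).
Hypothesis fd : is_density f.

Let mf : measurable_fun setT f. Proof. by case: fd. Qed.
Let f0 x : 0 <= f x. Proof. by case: fd => _ []. Qed.

Lemma lintegrable_density : lintegrable f.
Proof.
apply/integrableP; split; first exact/measurable_EFinP.
have -> : (\int[lebesgue_measure]_x `|(EFin \o f) x| = 1)%E; last exact: ltry.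
case: fd => _ [_ <-]; apply: eq_integral => x _ /=; by rewrite ger0_norm.
Qed.

Lemma lintegrable_pdomain q : pdomain f q -> lintegrable (fun x => `|x| `^ (q - 1) * f x).
Proof.
move=> [_ iq]; apply/integrableP; split.
  apply/measurable_EFinP; apply: measurable_funM => //.
  by apply: (measurableT_comp (measurable_powR _)); exact: normr_measurable.
apply: le_lt_trans iq; rewrite le_eqVlt; apply/orP; left; apply/eqP.
by apply: eq_integral => x _ /=; rewrite (ger0_norm (mulr_ge0 (powR_ge0 _ _) (f0 x))).
Qed.

Lemma pdomain_le q Q : 1 <= q <= Q -> pdomain f Q -> pdomain f q.
Proof.
move=> qQ DQ; split; first by lra.
have i1 := lintegrableD lintegrable_density (lintegrable_pdomain DQ).
have : lintegrable (fun x => `|x| `^ (q - 1) * f x).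
  apply: lintegrable_le i1 _.
    apply: measurable_funM => //.
    by apply: (measurableT_comp (measurable_powR _)); exact: normr_measurable.
  move=> x /=; rewrite [leLHS]ger0_norm; last by rewrite mulr_ge0 ?powR_ge0.
  rewrite -{2}(mul1r (f x)) -mulrDl ler_wpM2r// powR_le1D//; lra.
case/integrableP => _; apply: le_lt_trans; rewrite le_eqVlt; apply/orP; left; apply/eqP.
by apply: eq_integral => x _ /=; rewrite (ger0_norm (mulr_ge0 (powR_ge0 _ _) (f0 x))).
Qed.

(** A sum is at most twice its larger term, which separates a moment about 0 from a constant. The
    pair a = 1, c = 0 gives moments about v, and a = 2, c = 1 the last term of [slope_bound]. *)
Lemma lintegrable_affine_powR Q a c v : pdomain f Q -> 0 <= a -> 0 <= c ->
  lintegrable (fun x => (a * `|x - v| + c) `^ (Q - 1) * f x).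
Proof.
move=> DQ a0 c0; pose c' := a * `|v| + c.
have c'0 : 0 <= c' by rewrite addr_ge0// mulr_ge0.
have Q1 : 0 <= Q - 1 by case: DQ => + _; lra.
have ib := lintegrableD (lintegrableZ ((2 * a) `^ (Q - 1)) (lintegrable_pdomain DQ))
  (lintegrableZ ((2 * c') `^ (Q - 1)) lintegrable_density).
apply: lintegrable_le ib _.
  apply: measurable_funM => //.
  apply: (measurableT_comp (measurable_powR _)); apply: measurable_funD => //.
  apply: measurable_funM => //; apply: measurableT_comp => //.
  exact: measurable_funB.
move=> x /=; rewrite [leLHS]ger0_norm; last by rewrite mulr_ge0 ?powR_ge0.
rewrite mulrA -mulrDl ler_wpM2r//.
have mono (s t : R) : 0 <= s -> s <= t -> s `^ (Q - 1) <= t `^ (Q - 1).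
  by move=> s0 st; apply: ge0_ler_powR => //; rewrite ?nnegrE; lra.
rewrite -powRM ?mulr_ge0//.
have ax0 : 0 <= a * `|x| by rewrite mulr_ge0.
have le1 : a * `|x - v| + c <= a * `|x| + c'.
  rewrite /c' addrA lerD2r -mulrDr ler_wpM2l//; exact: ler_normB.
have n0 : 0 <= a * `|x - v| + c by rewrite addr_ge0// mulr_ge0.
have [h|h] := leP (a * `|x|) c'.
  by rewrite (@le_trans _ _ ((2 * c') `^ (Q - 1))) ?mono ?lerDr ?powR_ge0//; lra.
by rewrite (@le_trans _ _ ((2 * a * `|x|) `^ (Q - 1))) ?mono ?lerDl ?powR_ge0//; lra.
Qed.

Lemma measurable_spow_density (q v : R) : measurable_fun setT (fun x : R => spow q (x - v) * f x).
Proof.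
apply: measurable_funM => //; apply: (measurableT_comp (measurable_spow q)).
exact: measurable_funB.
Qed.

Lemma lintegrable_spow_bound Q v : pdomain f Q ->
  lintegrable (fun x => (1 + `|x - v| `^ (Q - 1)) * f x).
Proof.
move=> DQ; have /= := lintegrableD lintegrable_density
  (lintegrable_affine_powR v DQ ler01 (lexx 0)).
by apply: eq_integrable => // x _ /=; rewrite mulrDl !mul1r addr0.
Qed.

Lemma lintegrable_spow q v : pdomain f q -> lintegrable (fun x => spow q (x - v) * f x).
Proof.
move=> Dq; apply: lintegrable_le (lintegrable_spow_bound v Dq) _.
  exact: measurable_spow_density.
move=> x; rewrite normrM (ger0_norm (f0 x)) ler_wpM2r// norm_spow_le//.
by case: Dq => + _; lra.
Qed.

Lemma ppow_le_spow (q u : R) : ppow u q <= `|spow q u|.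
Proof.
have [u0|u0] := ltP 0 u; last by rewrite /ppow ltNge u0 /=.
by rewrite spow_gt0E// /ppow u0 ler_norm.
Qed.

Lemma lintegrable_ppow q v : pdomain f q -> lintegrable (fun x => ppow (x - v) q * f x) /\
  lintegrable (fun x => ppow (v - x) q * f x).
Proof.
move=> Dq; have q1 : 1 <= q <= q by case: Dq => + _; lra.
split; apply: lintegrable_le (lintegrable_spow_bound v Dq) _.
- apply: measurable_funM => //; apply: (measurableT_comp (measurable_ppow q)).
  exact: measurable_funB.
- move=> x /=; rewrite [leLHS]ger0_norm ?mulr_ge0 ?ppow_ge0// ler_wpM2r//.
  exact: le_trans (ppow_le_spow _ _) (norm_spow_le _ q1).
- apply: measurable_funM => //; apply: (measurableT_comp (measurable_ppow q)).
  exact: measurable_funB.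
- move=> x /=; rewrite [leLHS]ger0_norm ?mulr_ge0 ?ppow_ge0// ler_wpM2r// distrC.
  exact: le_trans (ppow_le_spow _ _) (norm_spow_le _ q1).
Qed.

End densities.

(** * The balance function M(q, v) and the location of its zero *)

Definition pbalance (R : realType) (f : R -> R) (q v : R) : R :=
  \int[lebesgue_measure]_x (spow q (x - v) * f x).

(** [is_pmean] equates extended reals; on the domain both sides are finite and may be subtracted. *)
Lemma pbalance_is_pmean (R : realType) (f : R -> R) (q v : R) :
  is_density f -> pdomain f q -> is_pmean f q v -> pbalance f q v = 0.
Proof.
move=> fd Dq E; have [i1 i2] := lintegrable_ppow fd v Dq.
have {}E : \int[lebesgue_measure]_x (ppow (x - v) q * f x) =
    \int[lebesgue_measure]_x (ppow (v - x) q * f x) by rewrite /Rintegral E.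
transitivity (\int[lebesgue_measure]_x (ppow (x - v) q * f x - ppow (v - x) q * f x)).
  by apply: eq_Rintegral => x _; rewrite /spow opprB mulrBl.
by rewrite RintegralB// E subrr.
Qed.

Lemma interval_radius (R : realType) (L Rb : \bar R) (x : R) : (L < x%:E < Rb)%E ->
  exists2 r : R, 0 < r & forall y, `|y - x| < r -> (L < y%:E < Rb)%E.
Proof.
move=> xLR; have : \forall y \near x, (L < y%:E < Rb)%E.
  case/andP: xLR => Lx xR; near=> y; apply/andP; split; near: y.
  - case: L Lx => [l| |]//=; last by move=> _; apply: nearW => y; rewrite ltNyr.
    by rewrite lte_fin => lx; near do rewrite lte_fin; exact: lt_nbhsr.
  - case: Rb xR => [b| |]//=; last by move=> _; apply: nearW => y; rewrite ltry.
    by rewrite lte_fin => lx; near do rewrite lte_fin; exact: lt_nbhsl.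
move=> /nbhs_ballP[r /= r0 rB]; exists r => // y yx; apply: rB.
by rewrite /ball/= distrC.
Unshelve. all: by end_near.
Qed.

Section interval_densities.
Context (R : realType) (f : R -> R) (L Rb : \bar R).
Hypothesis fi : interval_density f L Rb.

Let fd : is_density f. Proof. by case: fi. Qed.
Let f0 x : 0 <= f x. Proof. by case: fd => _ []. Qed.

Lemma density_support x : 0 < f x -> (L < x%:E < Rb)%E.
Proof.
move=> fx; apply: contrapT => nx; move: fx.
by rewrite (id_support fi nx) ltxx.
Qed.

Lemma support_nonempty : exists x : R, (L < x%:E < Rb)%E.
Proof.
apply: contrapT => nex; case: fd => _ [_ /eqP]; rewrite integral0_eq; last first.
  move=> x _; rewrite (id_support fi)// => xLR; apply: nex; by exists x.
by rewrite eq_sym onee_eq0.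
Qed.

(** [f] may vanish at x0 itself. Density of {f > 0} supplies a point y near x0 with f y > 0, and
    continuity makes the integrand positive around y. *)
Lemma Rintegral_density_gt0 (g : R -> R) (x0 r : R) :
  lintegrable (fun x => g x * f x) -> (forall x, 0 <= g x) ->
  (L < x0%:E < Rb)%E -> 0 < r -> (forall x, `|x - x0| < r -> 0 < g x) ->
  0 < \int[lebesgue_measure]_x (g x * f x).
Proof.
move=> ig g0 x0LR r0 gpos.
have [y [yx0 fy]] := id_dense fi x0LR r0.
have fyc : \forall x \near y, 0 < f x.
  exact: (cvgr_gt (f y) (id_continuous fi (density_support fy)) 0 fy).
have yc : \forall x \near y, `|x - x0| < r.
  have yc : `|x - x0| @[x --> y] --> `|y - x0|.
    by apply: cvg_norm; apply: cvgB; [exact: cvg_id|exact: cvg_cst].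
  exact: (cvgr_lt _ yc _ yx0).
have : \forall x \near y, 0 < g x * f x.
  by near=> x; apply: mulr_gt0; [apply: gpos|]; near: x.
move=> /nbhs_ballP[d /= d0 dB].
apply: (@Rintegral_gt0 _ _ y d) => // [x|x xy]; first by rewrite mulr_ge0.
by apply: dB; rewrite /ball/= distrC.
Unshelve. all: by end_near.
Qed.

Lemma le_pbalance q v v' : pdomain f q -> v <= v' -> pbalance f q v' <= pbalance f q v.
Proof.
move=> Dq vv; apply: le_Rintegral => //; [exact: lintegrable_spow|exact: lintegrable_spow|].
by move=> x _; rewrite ler_wpM2r// le_spow//; [case: Dq|lra].
Qed.

(** For x near x0 the numbers x - v and x - v' have opposite signs, which gives strictness even for
    q = 1. *)
Lemma lt_pbalance q v v' x0 : pdomain f q -> v < x0 < v' -> (L < x0%:E < Rb)%E ->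
  pbalance f q v' < pbalance f q v.
Proof.
move=> Dq vxv x0LR; rewrite -subr_gt0 -RintegralB//; last 2 first.
- exact: lintegrable_spow.
- exact: lintegrable_spow.
rewrite (_ : Rintegral _ _ _ =
    \int[lebesgue_measure]_x ((spow q (x - v) - spow q (x - v')) * f x)); last first.
  by apply: eq_Rintegral => x _; exact/esym/mulrBl.
have q1 : 1 <= q by case: Dq.
apply: (@Rintegral_density_gt0 (fun x => spow q (x - v) - spow q (x - v')) x0
  (Num.min (x0 - v) (v' - x0))) => //.
- have := integrableB measurableT (lintegrable_spow fd v Dq) (lintegrable_spow fd v' Dq).
  by apply: eq_integrable => // x _ /=; rewrite -EFinB; congr EFin; exact/esym/mulrBl.
- by move=> x; rewrite subr_ge0 le_spow//; lra.
- by rewrite lt_min; lra.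
- move=> x; rewrite lt_min !ltr_distl => /andP[h1 h2].
  by rewrite subr_gt0; apply: lt_spow; lra.
Qed.

(** If v <= L, all the mass lies to the right of v and the balance is positive; if v >= Rb, it is
    negative. *)
Lemma pmean_in_support q v : pdomain f q -> is_pmean f q v -> (L < v%:E < Rb)%E.
Proof.
move=> Dq /(pbalance_is_pmean fd Dq) Mv.
have [x0 x0LR] := support_nonempty.
have [r r0 rB] := interval_radius x0LR.
apply/andP; split; rewrite ltNge; apply/negP => vL.
- have vx : v < x0 by rewrite -lte_fin (le_lt_trans vL)//; case/andP: x0LR.
  have : 0 < pbalance f q v.
    (* Truncation makes the weight nonnegative on the whole line; it changes values only where [f]
       vanishes. *)
    pose g x := if v < x then spow q (x - v) else 0.
    have E x : spow q (x - v) * f x = g x * f x.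
      rewrite /g; have [//|xv] := ltP v x; have -> : f x = 0; last by rewrite !mulr0.
      apply: (id_support fi) => /andP[Lx _]; have xL : (x%:E <= L)%E by rewrite (le_trans _ vL)// lee_fin.
      by have := lt_le_trans Lx xL; rewrite ltxx.
    have -> : pbalance f q v = \int[lebesgue_measure]_x (g x * f x).
      by apply: eq_Rintegral => x _; exact: E.
    apply: (@Rintegral_density_gt0 _ x0 (x0 - v)) => //.
    + by have := lintegrable_spow fd v Dq; apply: eq_integrable => // x _ /=; rewrite E.
    + by move=> x; rewrite /g; case: ifPn => // vx'; rewrite spow_gt0E ?powR_ge0// subr_gt0.
    + by lra.
    + move=> x; rewrite ltr_distl => /andP[xv _]; rewrite /g ifT; last by lra.
      by rewrite spow_gt0E ?powR_gt0//; lra.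
  by rewrite Mv ltxx.
- have vx : x0 < v by rewrite -lte_fin (lt_le_trans _ vL)//; case/andP: x0LR.
  have : 0 < - pbalance f q v.
    pose g x := if x < v then spow q (v - x) else 0.
    have E x : - 1 * (spow q (x - v) * f x) = g x * f x.
      rewrite mulN1r -mulNr -spowN opprB /g; have [//|xv] := ltP x v; have -> : f x = 0; last by rewrite !mulr0.
      apply: (id_support fi) => /andP[_ xR]; have Rx : (Rb <= x%:E)%E by rewrite (le_trans vL)// lee_fin.
      by have := lt_le_trans xR Rx; rewrite ltxx.
    have -> : - pbalance f q v = \int[lebesgue_measure]_x (g x * f x).
      rewrite /pbalance -mulN1r -RintegralZl//; last exact: lintegrable_spow.
      by apply: eq_Rintegral => x _; exact: E.
    apply: (@Rintegral_density_gt0 _ x0 (v - x0)) => //.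
    + have := lintegrableZ (- 1) (lintegrable_spow fd v Dq).
      by apply: eq_integrable => // x _ /=; rewrite E.
    + by move=> x; rewrite /g; case: ifPn => // vx'; rewrite spow_gt0E ?powR_ge0// subr_gt0.
    + by lra.
    + move=> x; rewrite ltr_distl => /andP[_ xv]; rewrite /g ifT; last by lra.
      by rewrite spow_gt0E ?powR_gt0//; lra.
  by rewrite Mv oppr0 ltxx.
Qed.

End interval_densities.

(* Clamping the exponent to [1, Q] turns one-sided limits at the endpoints of the domain
   into limits over a full neighborhood. *)
Definition clamp (R : realType) (a b x : R) : R := Num.max a (Num.min x b).

Lemma clamp_id (R : realType) (a b x : R) : a <= x <= b -> clamp a b x = x.
Proof. by move=> /andP[ax xb]; rewrite /clamp min_l// max_r. Qed.

Lemma clamp_itv (R : realType) (a b x : R) : a <= b -> a <= clamp a b x <= b.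
Proof. by move=> ab; rewrite /clamp le_max lexx/= ge_max ab ge_min lexx orbT. Qed.

Lemma clamp_cvg (R : realType) (a b p : R) : a <= p <= b ->
  clamp a b q @[q --> p] --> p.
Proof.
move=> apb; apply/cvgrPdist_lt => e e0; near=> q.
have : `|p - q| < e by near: q; exact: cvgr_dist_lt.
rewrite /clamp !ltr_distlC; have [qb|qb] := leP q b.
  by have [aq|aq] := leP a q; lra.
by have [ab|ab] := leP a b; lra.
Unshelve. all: by end_near.
Qed.

(** * Limits in the exponent and continuity of the p-mean *)

Section pbalance_limits.
Context (R : realType) (f : R -> R) (L Rb : \bar R).
Hypothesis fi : interval_density f L Rb.

Let fd : is_density f. Proof. by case: fi. Qed.
Let mf : measurable_fun setT f. Proof. by case: fd. Qed.
Let f0 x : 0 <= f x. Proof. by case: fd => _ []. Qed.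

Lemma pbalance_cvg Q p v : pdomain f Q -> 1 <= p <= Q ->
  pbalance f (clamp 1 Q q) v @[q --> p] --> pbalance f p v.
Proof.
move=> DQ pQ; have Q1 : 1 <= Q by lra.
rewrite -{2}(clamp_id pQ).
apply: (@cvg_Rintegral_dominated _ (fun q x => spow (clamp 1 Q q) (x - v) * f x)
  (fun x => (1 + `|x - v| `^ (Q - 1)) * f x) p 0 1 _ _ _ _ _).2 => //.
- by move=> q _; exact: measurable_spow_density.
- exact: lintegrable_spow_bound.
- move=> q x _ _; rewrite normrM (ger0_norm (f0 x)) ler_wpM2r//.
  by apply: norm_spow_le; exact: clamp_itv.
- move=> x _; apply: cvgMl; rewrite clamp_id//.
  exact: (cvg_comp _ _ (clamp_cvg pQ) (@spow_cvg R (x - v) p)).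
Qed.

(** M(p, .) has strict and opposite signs at nu p - e and nu p + e. Both signs persist for q near p,
    and monotonicity of M(q, .) traps its zero [nu q] in between. Restricting q to [1, Q] admits p =
    1 and p = Q. *)
Lemma pmean_continuous (nu : R -> R) (Q p e : R) :
  (forall q, pdomain f q -> is_pmean f q (nu q)) -> pdomain f Q -> 1 <= p <= Q ->
  0 < e -> \forall q \near p, 1 <= q <= Q -> `|nu q - nu p| < e.
Proof.
move=> nuE DQ pQ e0; have Dp := pdomain_le fd pQ DQ.
have [r r0 rB] := interval_radius (pmean_in_support fi Dp (nuE _ Dp)).
(* The points nu p ± d are in the support (d < r) and strictly between nu p and nu p ± e, as strict
   monotonicity requires. *)
pose d := Num.min r e / 2.
have [dr de d0] : [/\ d < r, d < e & 0 < d].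
  have m1 : 0 < Num.min r e by rewrite lt_min r0.
  have m2 : Num.min r e <= r by rewrite ge_min lexx.
  have m3 : Num.min r e <= e by rewrite ge_min lexx orbT.
  by rewrite /d; split; lra.
have M0 q : pdomain f q -> pbalance f q (nu q) = 0.
  by move=> Dq; exact: pbalance_is_pmean (nuE _ Dq).
have Mup : pbalance f p (nu p + e) < 0.
  rewrite -(M0 p Dp); apply: (@lt_pbalance _ _ _ _ fi _ _ _ (nu p + d)) => //; first lra.
  by apply: rB; rewrite addrC addKr gtr0_norm.
have Mdown : 0 < pbalance f p (nu p - e).
  rewrite -(M0 p Dp); apply: (@lt_pbalance _ _ _ _ fi _ _ _ (nu p - d)) => //; first lra.
  by apply: rB; rewrite addrC addKr normrN gtr0_norm.
near=> q => qQ.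
have Dq := pdomain_le fd qQ DQ.
have : pbalance f (clamp 1 Q q) (nu p + e) < 0.
  by near: q; exact: (cvgr_lt _ (pbalance_cvg DQ pQ) _ Mup).
have : 0 < pbalance f (clamp 1 Q q) (nu p - e).
  by near: q; exact: (cvgr_gt _ (pbalance_cvg DQ pQ) _ Mdown).
rewrite clamp_id// -(M0 q Dq) => h1 h2; rewrite ltr_distl; apply/andP; split.
  rewrite ltNge; apply/negP => /(le_pbalance fi Dq); rewrite leNgt h1; exact/notF.
rewrite ltNge; apply/negP => /(le_pbalance fi Dq); rewrite leNgt h2; exact/notF.
Unshelve. all: by end_near.
Qed.

(** Only the singular term is delicate. Within d of v the density is at most C, and |u|^(q0-2) is
    integrable near 0 as q0 > 1. Farther away the singular factor is at most d^(q0-2) if q0 < 2 and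
    at most 1 otherwise, and [f] is integrable. *)
Lemma lintegrable_slope_bound q0 Q v : 1 < q0 -> pdomain f Q -> (L < v%:E < Rb)%E ->
  lintegrable (fun x => slope_bound q0 Q (x - v) * f x).
Proof.
move=> q01 DQ vLR.
have [C [d [C0 d0 d1 Cd]]] : exists C d, [/\ 0 <= C, 0 < d, d < 1 &
    forall x, `|x - v| < d -> f x <= C].
  have : \forall x \near v, f x < f v + 1.
    by apply: (cvgr_lt _ (id_continuous fi vLR)); lra.
  move=> /nbhs_ballP[d /= d0 dB]; exists (f v + 1), (Num.min d (1/2)); split.
  - by rewrite addr_ge0.
  - by rewrite lt_min d0/=; lra.
  - by rewrite gt_min; apply/orP; right; lra.
  - move=> x; rewrite lt_min => /andP[xd _]; apply/ltW/dB.
    by rewrite /ball/= distrC.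
pose s (u : R) := `|u| `^ (q0 - 2) * (0 < `|u| < 1)%R%:R.
have ms : measurable_fun setT s.
  apply: measurable_funM.
    by apply: (measurableT_comp (measurable_powR _)); exact: normr_measurable.
  by apply: measurable_fun_boolr; apply: measurable_and;
    apply: measurable_fun_ltr => //; exact: normr_measurable.
have is1 : lintegrable (fun x => s (x - v) * f x).
  have iq : lintegrable s by apply: integrable_powR_near0; lra.
  have ib := lintegrableD (lintegrableZ C (integrable_translation v iq))
    (lintegrableZ (d `^ (q0 - 2) + 1) (lintegrable_density fd)).
  apply: lintegrable_le ib _.
    apply: measurable_funM => //; apply: (measurableT_comp ms).
    exact: measurable_funB.
  move=> x /=; have s0 : 0 <= s (x - v) by rewrite mulr_ge0 ?powR_ge0.
  have p0 := powR_ge0 d (q0 - 2).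
  rewrite ger0_norm ?mulr_ge0//.
  have [xd|xd] := ltP `|x - v| d.
    rewrite mulrC (@le_trans _ _ (C * s (x - v))) ?lerDl ?mulr_ge0 ?addr_ge0//.
    by rewrite ler_wpM2r// Cd.
  rewrite (@le_trans _ _ ((d `^ (q0 - 2) + 1) * f x)) ?lerDr ?mulr_ge0//.
  rewrite ler_wpM2r// /s; case: (ltP `|x - v| 1) => x1; last first.
    by rewrite andbF mulr0 addr_ge0.
  rewrite (lt_le_trans d0 xd) mulr1.
  have u0 : 0 < `|x - v| by exact: lt_le_trans xd.
  have [q2|/ltW q2] := leP 0 (q0 - 2).
    rewrite (@le_trans _ _ 1) ?lerDr// -[leRHS](powRr0 `|x - v|).
    by apply: ger_powR => //; rewrite ?u0 ?(ltW x1).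
  rewrite (@le_trans _ _ (d `^ (q0 - 2)))// ?lerDl//.
  have -> : q0 - 2 = - (2 - q0) by lra.
  rewrite !powRN lef_pV2 ?posrE ?powR_gt0//.
  by apply: ge0_ler_powR; rewrite ?nnegrE ?(ltW d0) ?(ltW u0)//; lra.
have i2 := lintegrableZ (2 + Q) (lintegrable_density fd).
have i3 := lintegrableZ Q (lintegrable_affine_powR fd v DQ (ler0n R 2) ler01).
have := lintegrableD (lintegrableZ 2 is1) (lintegrableD i2 i3).
apply: eq_integrable => // x _ /=; congr EFin; rewrite /slope_bound -/(s (x - v)).
ring.
Qed.

End pbalance_limits.

(** * Differentiability of the p-mean *)

Section pmean_derivative.
Context (R : realType) (f : R -> R) (L Rb : \bar R).
Hypothesis fi : interval_density f L Rb.

Let fd : is_density f. Proof. by case: fi. Qed.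
Let mf : measurable_fun setT f. Proof. by case: fd. Qed.
Let f0 x : 0 <= f x. Proof. by case: fd => _ []. Qed.

Lemma measurable_spow_slope (q h v : R) :
  measurable_fun setT (fun x : R => spow_slope q (x - v) h).
Proof.
rewrite /spow_slope; case: (h == 0).
  apply: measurable_funM => //; apply: (measurableT_comp (measurable_powR _)).
  by apply: measurableT_comp => //; exact: measurable_funB.
apply: measurable_funM => //; apply: measurable_funB.
  by apply: (measurableT_comp (measurable_spow q)); exact: measurable_funB.
by apply: (measurableT_comp (measurable_spow q)); do 2 apply: measurable_funB => //.
Qed.

Lemma measurable_spow_logslope (p q v : R) :
  measurable_fun setT (fun x : R => spow_logslope p q (x - v)).
Proof.
have ms t : measurable_fun setT (fun x : R => spow t (x - v)).
  by apply: (measurableT_comp (measurable_spow t)); exact: measurable_funB.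
rewrite /spow_logslope; case: (q == p).
  apply: measurable_funM => //; apply: (measurableT_comp (@measurable_ln R)).
  by apply: measurableT_comp => //; exact: measurable_funB.
by apply: measurable_funM => //; exact: measurable_funB.
Qed.

Lemma interior_pdomain p : interior (pdomain f) p ->
  exists e, [/\ 0 < e, 1 < p - e & pdomain f (p + e)].
Proof.
move=> /nbhs_ballP[d /= d0 dB]; exists (d / 2); split; first lra.
(* A point of the domain strictly to the left of p - d/2 makes 1 < p - e strict. *)
- have : pdomain f (p - d / 2 - d / 4) by apply: dB; rewrite /ball/= gtr0_norm; lra.
  by case => + _; lra.
- by apply: dB; rewrite /ball/= ltr0_norm; lra.
Qed.

Lemma spow_slope_integral_cvg p v (h : R -> R) : interior (pdomain f) p ->
  (L < v%:E < Rb)%E -> h p = 0 -> h q @[q --> p] --> (0 : R) ->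
  lintegrable (fun x => spow_slope p (x - v) 0 * f x) /\
  \int[lebesgue_measure]_x (spow_slope q (x - v) (h q) * f x) @[q --> p] -->
  \int[lebesgue_measure]_x (spow_slope p (x - v) 0 * f x).
Proof.
move=> /interior_pdomain[e [e0 pe1 Dpe]] vLR hp0 hp.
have : \forall q \near p, `|h q| <= 1.
  have n0 : `|h q| @[q --> p] --> `|0 : R| by exact: cvg_norm.
  by apply: filterS (cvgr_lt _ n0 1 _) => [q /ltW//|]; rewrite normr0.
move=> /nbhs_ballP[d /= d0 dB].
have m0 : 0 < Num.min d e by rewrite lt_min d0.
have := @cvg_Rintegral_dominated _ (fun q x => spow_slope q (x - v) (h q) * f x)
  (fun x => slope_bound (p - e) (p + e) (x - v) * f x) p v (Num.min d e) m0.
rewrite hp0; case.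
- by move=> q _; apply: measurable_funM => //; exact: measurable_spow_slope.
- exact: (lintegrable_slope_bound fi pe1 Dpe vLR).
- move=> q x; rewrite lt_min => /andP[qd qe] xv.
  rewrite normrM (ger0_norm (f0 x)) ler_wpM2r//; apply: norm_spow_slope_le => //.
  + by move: qe; rewrite ltr_distl; lra.
  + by apply: dB; rewrite /ball/= distrC.
  + by rewrite subr_eq0.
- move=> x xv; apply: cvgMl; have xv0 : x - v != 0 by rewrite subr_eq0.
  by have := @spow_slope_cvg _ p _ h xv0 hp0 hp; rewrite hp0; apply.
- move=> ik ck; split => //.
  by have := ik p; rewrite subrr normr0 hp0; apply.
Qed.

Lemma spow_logslope_integral_cvg p v : interior (pdomain f) p ->
  lintegrable (fun x => spow_logslope p p (x - v) * f x) /\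
  \int[lebesgue_measure]_x (spow_logslope p q (x - v) * f x) @[q --> p] -->
  \int[lebesgue_measure]_x (spow_logslope p p (x - v) * f x).
Proof.
move=> /interior_pdomain[e [e0 pe1 Dpe]].
(* One half of e is the range of q, the other half the shift of the exponent that absorbs the
   logarithm. *)
have e20 : 0 < e / 2 by lra.
have := @cvg_Rintegral_dominated _ (fun q x => spow_logslope p q (x - v) * f x)
  (fun x => 4 * (e / 2)^-1 * ((1 + `|x - v| `^ (p + e - 1)) * f x)) p v (e / 2) e20.
case.
- by move=> q _; apply: measurable_funM => //; exact: measurable_spow_logslope.
- by apply: lintegrableZ; exact: lintegrable_spow_bound.
- move=> q x qp _.
  rewrite normrM (ger0_norm (f0 x)) mulrA ler_wpM2r//.
  by apply: norm_spow_logslope_le => //; move: qp; rewrite ltr_distl; lra.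
- by move=> x _; apply: cvgMl; exact: spow_logslope_cvg.
- move=> ik ck; split => //.
  by have := ik p; rewrite subrr normr0; apply.
Qed.

Lemma spow_slope_integral_gt0 p v : interior (pdomain f) p -> (L < v%:E < Rb)%E ->
  0 < \int[lebesgue_measure]_x (spow_slope p (x - v) 0 * f x).
Proof.
move=> Dp vLR; have [r r0 rB] := interval_radius vLR.
have p1 : 1 < p by have [e [e0 pe1 _]] := interior_pdomain Dp; lra.
have [ik _] := spow_slope_integral_cvg (h := fun=> 0) Dp vLR erefl (cvg_cst _).
(* The ball is centred off v and avoids it, because |x - v|^(p-2) is sure to be positive only for x
   other than v. *)
apply: (@Rintegral_density_gt0 _ _ _ _ fi (fun x => spow_slope p (x - v) 0) (v + r / 2) (r / 2)) => //.
- by move=> x; rewrite /spow_slope eqxx mulr_ge0 ?powR_ge0//; lra.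
- by apply: rB; rewrite addrC addKr gtr0_norm; lra.
- lra.
- move=> x; rewrite ltr_distl => /andP[h1 h2]; rewrite /spow_slope eqxx.
  apply: mulr_gt0; first lra.
  by apply: powR_gt0; rewrite normr_gt0 subr_eq0 gt_eqF//; lra.
Qed.

(** The product form includes h = 0, where the slope is a derivative and both sides are 0. *)
Lemma spow_slope_integralM q v h : pdomain f q ->
  h * \int[lebesgue_measure]_x (spow_slope q (x - v) h * f x) =
  pbalance f q v - pbalance f q (v + h).
Proof.
move=> Dq; have [->|h0] := eqVneq h 0; first by rewrite mul0r addr0 subrr.
have i1 := lintegrable_spow fd v Dq; have i2 := lintegrable_spow fd (v + h) Dq.
have i12 : lintegrable (fun x => spow q (x - v) * f x - spow q (x - (v + h)) * f x).
  by have := integrableB measurableT i1 i2.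
rewrite /pbalance -RintegralB//; apply: (canLR (mulVKf h0)); rewrite -RintegralZl//.
apply: eq_Rintegral => x _; rewrite /spow_slope (negPf h0).
rewrite (_ : x - v - h = x - (v + h)); last by rewrite [in RHS]opprD addrA.
by rewrite -mulrBl mulrA; congr (_ * _); rewrite mulrC.
Qed.

Lemma spow_logslope_integralM p q v : pdomain f p -> pdomain f q ->
  (q - p) * \int[lebesgue_measure]_x (spow_logslope p q (x - v) * f x) =
  pbalance f q v - pbalance f p v.
Proof.
move=> Dp Dq; have [->|qp] := eqVneq q p; first by rewrite !subrr mul0r.
have i1 := lintegrable_spow fd v Dq; have i2 := lintegrable_spow fd v Dp.
have i12 : lintegrable (fun x => spow q (x - v) * f x - spow p (x - v) * f x).
  by have := integrableB measurableT i1 i2.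
rewrite /pbalance -RintegralB//; apply: canLR; first by apply: mulVKf; rewrite subr_eq0.
rewrite -RintegralZl//; apply: eq_Rintegral => x _; rewrite /spow_logslope (negPf qp).
by rewrite -mulrBl mulrA; congr (_ * _); rewrite mulrC.
Qed.

Lemma is_derive_pmean (nu : R -> R) (p : R) :
  (forall q, pdomain f q -> is_pmean f q (nu q)) -> interior (pdomain f) p ->
  is_derive p (1 : R) nu
    (\int[lebesgue_measure]_x (spow_logslope p p (x - nu p) * f x) /
     \int[lebesgue_measure]_x (spow_slope p (x - nu p) 0 * f x)).
Proof.
move=> nuE iDp; have Dp := nbhs_singleton iDp.
have [e [e0 pe1 Dpe]] := interior_pdomain iDp.
have nuLR := pmean_in_support fi Dp (nuE _ Dp).
have pe : 1 <= p <= p + e by lra.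
have nearD : \forall q \near p, 1 <= q <= p + e.
  apply/nbhs_ballP; exists e => //= q; rewrite /ball/= ltr_distlC; lra.
have nuc : (fun q => nu q - nu p) q @[q --> p] --> (0 : R).
  apply/cvgr0Pnorm_lt => s s0.
  apply: filterS2 nearD (pmean_continuous fi nuE Dpe pe s0) => q qp; exact.
have [_ cA] := spow_slope_integral_cvg (h := fun q => nu q - nu p) iDp nuLR (subrr _) nuc.
have [_ cB] := spow_logslope_integral_cvg (nu p) iDp.
have A0 := spow_slope_integral_gt0 iDp nuLR.
set A := (fun q => \int[lebesgue_measure]_x (spow_slope q (x - nu p) (nu q - nu p) * f x)) in cA.
set B := (fun q => \int[lebesgue_measure]_x (spow_logslope p q (x - nu p) * f x)) in cB.
set a := Rintegral _ _ _ in cA A0 *; set b := Rintegral _ _ _ in cB *.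
(* Both sides equal M(q, nu p): the left one because M(q, nu q) = 0, the right one because M(p, nu
   p) = 0. *)
have key : \forall q \near p, (nu q - nu p) * A q = (q - p) * B q.
  apply: filterS nearD => q qp; have Dq := pdomain_le fd qp Dpe.
  rewrite /A /B spow_slope_integralM// spow_logslope_integralM//.
  rewrite [nu p + _]addrC subrK (pbalance_is_pmean fd Dq (nuE _ Dq)).
  by rewrite (pbalance_is_pmean fd Dp (nuE _ Dp)).
have cquot : (nu q - nu p) / (q - p) @[q --> p^'] --> b / a.
  have cBA : B q / A q @[q --> p^'] --> b / a.
    apply: cvgM; first exact: cvg_within_filter.
    by apply: cvgV; [rewrite gt_eqF|exact: cvg_within_filter].
  apply: cvg_trans cBA; apply: near_eq_cvg.
  have Apos : \forall q \near p^', 0 < A q.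
    by apply: cvg_within; exact: (cvgr_gt _ cA 0 A0).
  have key' : \forall q \near p^', (nu q - nu p) * A q = (q - p) * B q.
    exact: cvg_within.
  near=> q.
  have qp : q - p != 0 by rewrite subr_eq0; near: q; exact: nbhs_dnbhs_neq.
  have Aq : A q != 0 by rewrite gt_eqF//; near: q.
  have kq : (nu q - nu p) * A q = (q - p) * B q by near: q.
  by apply/eqP; rewrite eqr_div// [B q * _]mulrC -kq.
have cd : h^-1 *: ((nu \o shift p) (h *: (1 : R)) - nu p) @[h --> 0^'] --> b / a.
  apply/cvgrPdist_lt => s s0.
  move/cvgrPdist_lt : cquot => /(_ s s0) /nbhs_ballP[d /= d0 dB].
  apply/nbhs_ballP; exists d => //= h; rewrite /ball/= sub0r normrN => hd h0.
  have := dB (h + p); rewrite /ball/= opprD addrCA subrr addr0 normrN => /(_ hd).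
  rewrite -subr_eq0 addrK => /(_ h0); rewrite /GRing.scale/= mulr1.
  by rewrite [h^-1 * _]mulrC.
split; first by apply/cvg_ex; exists (b / a).
exact: cvg_lim cd.
Unshelve. all: by end_near.
Qed.

End pmean_derivative.

(** * Stochastic dominance and the logarithm *)

Lemma eq_Rintegral_except (R : realType) (c : R) (g h : R -> R) :
  measurable_fun setT g -> measurable_fun setT h -> (forall x, x != c -> g x = h x) ->
  \int[lebesgue_measure]_x g x = \int[lebesgue_measure]_x h x.
Proof.
move=> mg mh gh; congr fine; apply: ae_eq_integral => //; [exact/measurable_EFinP..|].
exists [set c]; split => //=; first exact: lebesgue_measure_set1.
move=> x /= nE; apply/eqP/negPn; apply/negP => /gh E; apply: nE => _.
by rewrite E.
Qed.

(** [Num.max 0 (phi y)] is the length of [0, phi y[, so Tonelli applies. Only the positive part of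
    [phi] is seen; the logarithm is therefore treated through [ln] and [- ln]. *)
Lemma integral_layer_cake (R : realType) (phi g : R -> R) :
  measurable_fun setT phi -> measurable_fun setT g -> (forall y, 0 <= g y) ->
  measurable_fun setT (fun t : R =>
    \int[lebesgue_measure]_y ((0 <= t < phi y)%R%:R * g y)%:E)%E /\
  (\int[lebesgue_measure]_y (Num.max 0 (phi y) * g y)%:E =
   \int[lebesgue_measure]_t \int[lebesgue_measure]_y ((0 <= t < phi y)%R%:R * g y)%:E)%E.
Proof.
move=> mphi mg g0.
pose k (p : measurableTypeR R * measurableTypeR R) := ((0 <= p.2 < phi p.1)%R%:R * g p.1)%:E.
have mk : measurable_fun setT k.
  apply/measurable_EFinP; apply: measurable_funM.
    apply: measurable_fun_boolr; apply: measurable_and.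
      by apply: measurable_fun_ler => //; exact: measurable_snd.
    apply: measurable_fun_ltr; first exact: measurable_snd.
    by apply: (measurableT_comp mphi); exact: measurable_fst.
  by apply: (measurableT_comp mg); exact: measurable_fst.
have k0 p : (0 <= k p)%E by rewrite lee_fin mulr_ge0.
split.
  exact: (@measurable_fun_fubini_tonelli_G _ _ _ _ _ lebesgue_measure k).
rewrite -(@fubini_tonelli _ _ _ _ _ lebesgue_measure lebesgue_measure k)//.
apply: eq_integral => y _; rewrite /k/=.
transitivity ((g y)%:E * \int[lebesgue_measure]_t (\1_[set` `[0, phi y[%R] t)%:E)%E.
  rewrite integral_indic// setIT [X in (_ * X)%E](lebesgue_measure_itv `[0, phi y[%R)/= lte_fin.
  have [h|h] := ltP 0 (phi y); last by rewrite mule0 mul0r.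
  by rewrite oppr0 adde0 -EFinM mulrC.
rewrite -ge0_integralZl//.
- by apply: eq_integral => t _; rewrite -EFinM indicE mem_setE in_itv/= mulrC.
- by apply/measurable_EFinP; exact: measurable_indic.
- by rewrite lee_fin.
Qed.

Lemma Rintegral_layer_cake (R : realType) (phi g : R -> R) :
  measurable_fun setT phi -> lintegrable g -> (forall y, 0 <= g y) ->
  lintegrable (fun y => phi y * g y) ->
  lintegrable (fun t => \int[lebesgue_measure]_y ((0 <= t < phi y)%R%:R * g y)) /\
  \int[lebesgue_measure]_t \int[lebesgue_measure]_y ((0 <= t < phi y)%R%:R * g y) =
  \int[lebesgue_measure]_y (Num.max 0 (phi y) * g y).
Proof.
move=> mphi ig g0 iphi.
have mg : measurable_fun setT g by case/integrableP : ig => /measurable_EFinP.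
have [mT E] := integral_layer_cake mphi mg g0.
have iin t : lintegrable (fun y => (0 <= t < phi y)%R%:R * g y).
  apply: lintegrable_le ig _.
    apply: measurable_funM => //; apply: measurable_fun_boolr; apply: measurable_and => //.
    exact: measurable_fun_ltr.
  by move=> y; rewrite normrM (ger0_norm (g0 y)); case: (_ && _); rewrite ?normr1 ?normr0 ?mul1r ?mul0r.
pose T t := \int[lebesgue_measure]_y ((0 <= t < phi y)%R%:R * g y).
have T0 t : 0 <= T t by apply: Rintegral_ge0 => y _; rewrite mulr_ge0.
have Ein t : (\int[lebesgue_measure]_y ((0 <= t < phi y)%R%:R * g y)%:E = (T t)%:E)%E.
  by rewrite fineK//; exact: integrable_fin_num (iin t).
have imax : lintegrable (fun y => Num.max 0 (phi y) * g y).
  have ib : lintegrable (fun y => `|phi y * g y|) by have := integrable_abse iphi.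
  apply: lintegrable_le ib _.
    by apply: measurable_funM => //; exact: measurable_maxr.
  move=> y; rewrite !normrM ler_wpM2r//.
  by have [h|h] := ltP 0 (phi y); rewrite ?normr0.
have {}E : (\int[lebesgue_measure]_y (Num.max 0 (phi y) * g y)%:E =
    \int[lebesgue_measure]_t (T t)%:E)%E.
  by rewrite E; apply: eq_integral => t _; rewrite Ein.
split; last by rewrite -/T /Rintegral E.
apply/integrableP; split.
  by apply: eq_measurable_fun mT => t _; rewrite /= -Ein.
rewrite (_ : integral _ _ _ = \int[lebesgue_measure]_t (T t)%:E)%E; last first.
  by apply: eq_integral => t _ /=; rewrite (ger0_norm (T0 t)).
by rewrite -E -ge0_fin_numE ?integrable_fin_num// integral_ge0// => y _; rewrite lee_fin mulr_ge0// le_max lexx.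
Qed.

Definition rcdf (R : realType) (g : R -> R) (x : R) : R :=
  \int[lebesgue_measure]_y ((y <= x)%R%:R * g y).

Section rcdf.
Context (R : realType) (g : R -> R).
Hypothesis ig : lintegrable g.
Hypothesis g0 : forall y, 0 <= g y.

Let mg : measurable_fun setT g. Proof. by case/integrableP : ig => /measurable_EFinP. Qed.

Lemma lintegrable_boolM (P : R -> bool) : measurable_fun setT P ->
  lintegrable (fun y => (P y)%:R * g y).
Proof.
move=> mP; apply: lintegrable_le ig _.
  by apply: measurable_funM => //; exact: measurable_fun_boolr.
by move=> y; rewrite normrM (ger0_norm (g0 y)); case: (P y); rewrite ?normr1 ?normr0 ?mul1r ?mul0r.
Qed.

Lemma cdfE x : Defs.cdf g x = (rcdf g x)%:E.
Proof.
rewrite /rcdf fineK; last first.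
  apply: integrable_fin_num => //; apply: lintegrable_boolM.
  exact: measurable_fun_ler.
rewrite /Defs.cdf [LHS]integral_mkcond; apply: eq_integral => y _.
by rewrite patchE mem_setE in_itv/=; case: (y <= x); rewrite ?mul1r ?mul0r.
Qed.

(** As z tends to x, the truth value of y <= z is eventually constant for every y except x, and a
    single point is null. *)
Lemma rcdf_cvg x : rcdf g y @[y --> x] --> rcdf g x.
Proof.
apply: (@cvg_Rintegral_dominated _ (fun x y => (y <= x)%R%:R * g y) g x x 1 _ _ _ _ _).2 => //.
- move=> z _; apply: measurable_funM => //; apply: measurable_fun_boolr.
  exact: measurable_fun_ler.
- by move=> z y _ _; rewrite normrM (ger0_norm (g0 y)); case: (y <= z); rewrite ?normr1 ?normr0 ?mul1r ?mul0r.
- move=> y yx; apply: cvgMl; apply: cvg_near_cst.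
  have [h|h|E] := ltgtP y x; last by rewrite E eqxx in yx.
  + by near=> z; rewrite (_ : y <= z)//; near: z; apply: filterS (lt_nbhsr h) => z /ltW.
  + by near=> z; rewrite (_ : y <= z = false)//; apply/negbTE; rewrite -ltNge; near: z; exact: lt_nbhsl.
Unshelve. all: by end_near.
Qed.

(** Asking for agreement only where [g] is nonzero lets the event be rewritten on the half-line that
    carries [g], where [ln] inverts [expR]. *)
Lemma rcdf_tail (E : R -> bool) x : measurable_fun setT E ->
  (forall y, g y != 0 -> E y = (x < y)) ->
  \int[lebesgue_measure]_y ((E y)%:R * g y) = \int[lebesgue_measure]_y g y - rcdf g x.
Proof.
move=> mE Ex; rewrite /rcdf -RintegralB//; last first.
  by apply: lintegrable_boolM; exact: measurable_fun_ler.
apply: eq_Rintegral => y _; have [->|gy] := eqVneq (g y) 0; first by rewrite !mulr0 subrr.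
by rewrite Ex// ltNge; case: (y <= x); rewrite ?mul1r ?mul0r ?subrr ?subr0.
Qed.

End rcdf.

Lemma Rintegral_ln_split (R : realType) (g : R -> R) :
  lintegrable (fun y => ln y * g y) -> measurable_fun setT g ->
  \int[lebesgue_measure]_y (ln y * g y) =
  \int[lebesgue_measure]_y (Num.max 0 (ln y) * g y) -
  \int[lebesgue_measure]_y (Num.max 0 (- ln y) * g y).
Proof.
move=> iln mg; have ib : lintegrable (fun y => `|ln y * g y|) by have := integrable_abse iln.
have mln := @measurable_ln R.
have ip : lintegrable (fun y => Num.max 0 (ln y) * g y).
  apply: lintegrable_le ib _.
    by apply: measurable_funM => //; exact: measurable_maxr.
  move=> y; rewrite !normrM ler_wpM2r//.
  by have [h|h] := ltP 0 (ln y); rewrite ?normr0.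
have im : lintegrable (fun y => Num.max 0 (- ln y) * g y).
  apply: lintegrable_le ib _.
    apply: measurable_funM => //; apply: measurable_maxr => //.
    exact: measurableT_comp.
  move=> y; rewrite !normrM ler_wpM2r//.
  by have [h|h] := ltP 0 (- ln y); rewrite ?normr0 ?normrN.
rewrite -RintegralB//; apply: eq_Rintegral => y _; rewrite -mulrBl; congr (_ * _).
by have [h|h] := ltP 0 (ln y); have [h'|h'] := ltP 0 (- ln y); lra.
Qed.

(** Under x = exp t the measure dx / x becomes dt. The layer cake yields this form directly: for t
    >= 0, the positive part of [ln] contributes D (exp t) and the negative part D (exp (- t)). Both
    integrals are nonnegative, and the one whose range contains a point x0 with D x0 > 0 is
    positive. *)
Lemma Rintegral_ln_lt (R : realType) (gY gZ : R -> R) :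
  lintegrable gY -> lintegrable gZ ->
  (forall y, 0 <= gY y) -> (forall y, 0 <= gZ y) ->
  (forall y, y <= 0 -> gY y = 0) -> (forall y, y <= 0 -> gZ y = 0) ->
  \int[lebesgue_measure]_y gY y = \int[lebesgue_measure]_y gZ y ->
  lintegrable (fun y => ln y * gY y) -> lintegrable (fun y => ln y * gZ y) ->
  strict_dominance gY gZ ->
  \int[lebesgue_measure]_y (ln y * gZ y) < \int[lebesgue_measure]_y (ln y * gY y).
Proof.
move=> iY iZ Y0 Z0 Yneg Zneg YZ ilnY ilnZ [dom neq].
have mY : measurable_fun setT gY by case/integrableP : iY => /measurable_EFinP.
have mZ : measurable_fun setT gZ by case/integrableP : iZ => /measurable_EFinP.
have mln := @measurable_ln R.
pose D x := rcdf gZ x - rcdf gY x.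
have D0 x : 0 <= D x.
  by have := dom x; rewrite !cdfE// lee_fin subr_ge0.
have [x0 Dx0] : exists x, 0 < D x.
  apply: contrapT => /forallNP nD; apply: neq; apply/funext => x.
  rewrite !cdfE//; congr EFin; apply/eqP; rewrite -subr_eq0 eq_le D0 andbT.
  by rewrite leNgt; apply/negP/nD.
(* Both distribution functions vanish up to 0, so they can differ only at positive points, where
   [ln x0] is meaningful. *)
have x0_gt0 : 0 < x0.
  rewrite ltNge; apply/negP => x0le; move: Dx0; rewrite /D /rcdf.
  have zero (g : R -> R) : (forall y, y <= 0 -> g y = 0) ->
      \int[lebesgue_measure]_y ((y <= x0)%R%:R * g y) = 0.
    move=> gneg; rewrite (@eq_Rintegral _ _ _ _ _ (cst 0)) ?Rintegral_cst ?mul0r// => y _ /=.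
    by have [yx|_] := leP y x0; rewrite ?mul0r// mul1r gneg// (le_trans yx).
  by rewrite !zero// subrr ltxx.
have cD x : D y @[y --> x] --> D x by apply: cvgB; exact: rcdf_cvg.
have cont (s : R -> R) t : {for t, continuous s} -> 0 < D (s t) ->
    \forall t' \near t, 0 < D (s t').
  move=> cs Dst.
  have cDs : D (s t') @[t' --> t] --> D (s t) by exact: (cvg_comp s D cs (cD (s t))).
  exact: (cvgr_gt _ cDs 0 Dst).
have [iYp EYp] := Rintegral_layer_cake mln iY Y0 ilnY.
have [iZp EZp] := Rintegral_layer_cake mln iZ Z0 ilnZ.
have mNln : measurable_fun setT (fun y : R => - ln y) by exact: measurableT_comp.
have iNY : lintegrable (fun y => - ln y * gY y).
  have := lintegrableZ (- 1) ilnY; apply: eq_integrable => // y _ /=.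
  by rewrite mulN1r mulNr.
have iNZ : lintegrable (fun y => - ln y * gZ y).
  have := lintegrableZ (- 1) ilnZ; apply: eq_integrable => // y _ /=.
  by rewrite mulN1r mulNr.
have [iYm EYm] := Rintegral_layer_cake mNln iY Y0 iNY.
have [iZm EZm] := Rintegral_layer_cake mNln iZ Z0 iNZ.
have regroup (x y z w : R) : x - y - (z - w) = (x - z) + (w - y) by ring.
rewrite !Rintegral_ln_split// -EYp -EZp -EYm -EZm -subr_gt0 regroup.
have plusE (g : R -> R) t : lintegrable g -> (forall y, 0 <= g y) -> (forall y, y <= 0 -> g y = 0) ->
    \int[lebesgue_measure]_y ((0 <= t < ln y)%R%:R * g y) =
    (0 <= t)%R%:R * (\int[lebesgue_measure]_y g y - rcdf g (expR t)).
  move=> ig g0 gneg; case: (leP 0 t) => t0 /=; last first.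
    rewrite mul0r (@eq_Rintegral _ _ _ _ _ (cst 0)) ?Rintegral_cst ?mul0r// => y _ /=.
    by rewrite mul0r.
  rewrite mul1r; apply: rcdf_tail => //; first exact: measurable_fun_ltr.
  move=> y gy; have y0 : 0 < y by rewrite ltNge; apply: contra gy => /gneg ->.
  by rewrite -[LHS]ltr_expR lnK ?posrE.
have minusE (g : R -> R) t : lintegrable g -> (forall y, 0 <= g y) -> (forall y, y <= 0 -> g y = 0) ->
    \int[lebesgue_measure]_y ((0 <= t < - ln y)%R%:R * g y) =
    (0 <= t)%R%:R * rcdf g (expR (- t)).
  move=> ig g0 gneg; case: (leP 0 t) => t0 /=; last first.
    rewrite mul0r (@eq_Rintegral _ _ _ _ _ (cst 0)) ?Rintegral_cst ?mul0r// => y _ /=.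
    by rewrite mul0r.
  have mg : measurable_fun setT g by case/integrableP : ig => /measurable_EFinP.
  (* The event is y < exp (- t), while [rcdf] counts y <= exp (- t); they differ at one point. *)
  rewrite mul1r; apply: (@eq_Rintegral_except _ (expR (- t))).
  - apply: measurable_funM => //; apply: measurable_fun_boolr.
    exact: measurable_fun_ltr.
  - apply: measurable_funM => //; apply: measurable_fun_boolr.
    exact: measurable_fun_ler.
  - move=> y yt; have [->|gy] := eqVneq (g y) 0; first by rewrite !mulr0.
    have y0 : 0 < y by rewrite ltNge; apply: contra gy => /gneg ->.
    by rewrite ltrNr -[ln y < - t]ltr_expR lnK ?posrE// lt_neqAle yt.
set a := Rintegral _ _ _; set c := Rintegral _ _ _.
set d := Rintegral _ _ _; set b := Rintegral _ _ _.
(* The terms are tails, that is, total mass minus distribution function; the equal masses cancel. *)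
have ac : a - c = \int[lebesgue_measure]_t ((0 <= t)%R%:R * D (expR t)).
  rewrite /a /c -(RintegralB measurableT iYp iZp); apply: eq_Rintegral => t _.
  by rewrite !plusE// YZ /D -mulrBr opprB [_ + (_ - _)]addrC addrA subrK.
have db : d - b = \int[lebesgue_measure]_t ((0 <= t)%R%:R * D (expR (- t))).
  rewrite /d /b -(RintegralB measurableT iZm iYm); apply: eq_Rintegral => t _.
  by rewrite !minusE// /D -mulrBr.
have iac : lintegrable (fun t => (0 <= t)%R%:R * D (expR t)).
  have := integrableB measurableT iYp iZp; apply: eq_integrable => // t _ /=.
  by rewrite -EFinB !plusE// YZ /D -mulrBr opprB [_ + (_ - _)]addrC addrA subrK.
have idb : lintegrable (fun t => (0 <= t)%R%:R * D (expR (- t))).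
  have := integrableB measurableT iZm iYm; apply: eq_integrable => // t _ /=.
  by rewrite -EFinB !minusE// /D -mulrBr.
have ac0 : 0 <= a - c by rewrite ac; apply: Rintegral_ge0 => t _; rewrite mulr_ge0.
have db0 : 0 <= d - b by rewrite db; apply: Rintegral_ge0 => t _; rewrite mulr_ge0.
clearbody a b c d; clear EYp EZp EYm EZm plusE minusE iYp iZp iYm iZm.
suff [ac_gt0|db_gt0] : 0 < a - c \/ 0 < d - b.
- exact: (ltr_wpDr db0 ac_gt0).
- exact: (ltr_wpDl ac0 db_gt0).
have [t0|t0] := leP 0 (ln x0).
- left; rewrite ac.
  have : \forall t \near ln x0, 0 < D (expR t).
    apply: cont; first exact: continuous_expR.
    by rewrite lnK// posrE.
  move=> /nbhs_ballP[r /= r0 rB].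
  have r20 : 0 < r / 2 by rewrite divr_gt0.
  (* If x0 = 1, a ball around ln x0 = 0 would leave t >= 0; its right half does not. *)
  apply: (Rintegral_gt0 (y := ln x0 + r / 2) iac _ r20) => [t|t].
    by rewrite mulr_ge0.
  rewrite ltr_distl => /andP[h1 h2].
  rewrite (_ : 0 <= t); last by clear -h1 t0; lra.
  by rewrite mul1r; apply: rB; rewrite /ball/= ltr_distlC; clear -h1 h2 r0; lra.
- right; rewrite db.
  have : \forall t \near - ln x0, 0 < D (expR (- t)).
    apply: (cont (fun t => expR (- t))).
      by apply: continuous_comp; [exact: opp_continuous|exact: continuous_expR].
    by rewrite opprK lnK// posrE.
  move=> /nbhs_ballP[r /= r0 rB].
  have m0 : 0 < Num.min r (- ln x0) by rewrite lt_min r0 oppr_gt0.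
  apply: (Rintegral_gt0 (y := - ln x0) idb _ m0) => [t|t].
    by rewrite mulr_ge0.
  rewrite lt_min => /andP[]; rewrite !ltr_distl => h1 h2.
  rewrite (_ : 0 <= t); last by clear -h2; lra.
  by rewrite mul1r; apply: rB; rewrite /ball/= ltr_distlC; clear -h1; lra.
Qed.

Lemma Rintegral_reflection (R : realType) (c : R) (g : R -> R) :
  measurable_fun setT g ->
  \int[lebesgue_measure]_x g (c - x) = \int[lebesgue_measure]_x g x.
Proof.
by move=> mg; congr fine; apply: (integral_reflection c (g := EFin \o g)); exact/measurable_EFinP.
Qed.

Lemma Rintegral_translation (R : realType) (c : R) (g : R -> R) :
  measurable_fun setT g ->
  \int[lebesgue_measure]_x g (c + x) = \int[lebesgue_measure]_x g x.
Proof.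
by move=> mg; congr fine; apply: (integral_translation c (g := EFin \o g)); exact/measurable_EFinP.
Qed.

Lemma lt_sube_real (R : realType) (y v : R) (b : \bar R) :
  (y%:E < b - v%:E)%E = ((v + y)%:E < b)%E.
Proof. by rewrite lteBrDr// -EFinD addrC. Qed.

Lemma lt_real_sube (R : realType) (y v : R) (a : \bar R) :
  (y%:E < v%:E - a)%E = (a < (v - y)%:E)%E.
Proof.
case: a => [a| |] //=; last by rewrite ltry ltNyr.
by rewrite -EFinB !lte_fin ltrBrDr ltrBrDl addrC.
Qed.

(** * The two densities of the statement and the sign of the numerator *)

Section dominance.
Context (R : realType) (f : R -> R) (L Rb : \bar R).
Hypothesis fi : interval_density f L Rb.

Let fd : is_density f. Proof. by case: fi. Qed.
Let mf : measurable_fun setT f. Proof. by case: fd. Qed.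
Let f0 x : 0 <= f x. Proof. by case: fd => _ []. Qed.

Lemma gplusE v p y : gplus f L Rb v p y = (Hp f L v p)^-1 * (ppow y p * f (v + y)).
Proof.
rewrite /gplus -mulrA; congr (_ * _); rewrite indicE /ppow.
have [y0|y0] := ltP 0 y; last first.
  by rewrite mul0r memNset ?mulr0// => -[/=]; rewrite ltNge y0.
have [yR|yR] := boolP (y%:E < Rb - v%:E)%E; first by rewrite mem_set ?mulr1.
rewrite (id_support fi) ?mulr0 ?mul0r// => /andP[_ vy].
by rewrite lt_sube_real vy in yR.
Qed.

Lemma minus_integrandE v p y :
  (y `^ (p - 1) * f (v - y)) * \1_([set y : R | 0 < y /\ (y%:E < v%:E - L)%E]) y =
  ppow y p * f (v - y).
Proof.
rewrite indicE /ppow.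
have [y0|y0] := ltP 0 y; last first.
  by rewrite mul0r memNset ?mulr0// => -[/=]; rewrite ltNge y0.
have [yL|yL] := boolP (y%:E < v%:E - L)%E; first by rewrite mem_set ?mulr1.
rewrite (id_support fi) ?mulr0 ?mul0r// => /andP[vy _].
by rewrite lt_real_sube vy in yL.
Qed.

Lemma gminusE v p y : gminus f L v p y = (Hp f L v p)^-1 * (ppow y p * f (v - y)).
Proof. by rewrite /gminus -mulrA minus_integrandE. Qed.

Lemma HpE v p : Hp f L v p = \int[lebesgue_measure]_x (ppow (v - x) p * f x).
Proof.
have mk : measurable_fun setT (fun x : R => ppow (v - x) p * f x).
  apply: measurable_funM => //; apply: (measurableT_comp (measurable_ppow p)).
  exact: measurable_funB.
rewrite -(Rintegral_reflection v mk); congr fine.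
rewrite [LHS]integral_mkcond; apply: eq_integral => y _.
rewrite opprB addrCA subrr addr0 -minus_integrandE patchE indicE.
by case: ifP => _; rewrite ?mulr1 ?mulr0.
Qed.

Lemma Hp_gt0 v p : pdomain f p -> (L < v%:E < Rb)%E -> 0 < Hp f L v p.
Proof.
move=> Dp vLR; have [r r0 rB] := interval_radius vLR; rewrite HpE.
apply: (@Rintegral_density_gt0 _ _ _ _ fi (fun x => ppow (v - x) p) (v - r / 2) (r / 2)) => //.
- by have [] := lintegrable_ppow fd v Dp.
- by move=> x; exact: ppow_ge0.
- by apply: rB; rewrite addrC addKr normrN gtr0_norm; lra.
- lra.
- move=> x; rewrite ltr_distl => /andP[h1 h2].
  have vx : 0 < v - x by lra.
  by rewrite /ppow vx powR_gt0.
Qed.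

(** The substitutions x = v + y and x = v - y turn the two sides of v into integrals of [ln] against
    the two densities. That these have equal mass, as [Rintegral_ln_lt] requires, is the p-mean
    equation itself. *)
Lemma spow_logslope_integral_gt0 v p : interior (pdomain f) p -> is_pmean f p v ->
  strict_dominance (gplus f L Rb v p) (gminus f L v p) ->
  0 < \int[lebesgue_measure]_x (spow_logslope p p (x - v) * f x).
Proof.
move=> iDp pm; have Dp := nbhs_singleton iDp.
have vLR := pmean_in_support fi Dp pm.
move: pm; have H0 := Hp_gt0 Dp vLR; set H := Hp f L v p in H0.
have [ilog _] := spow_logslope_integral_cvg fi v iDp.
pose G x := ln (x - v) * (ppow (x - v) p * f x).
pose G' x := ln (v - x) * (ppow (v - x) p * f x).
have logE x : spow_logslope p p (x - v) * f x = G x - G' x.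
  rewrite /spow_logslope eqxx /G /G' /spow /ppow opprB subr_gt0 subr_gt0.
  have [xv|xv|->] := ltgtP x v.
  - by rewrite ltr0_norm ?subr_lt0// opprB; ring.
  - by rewrite gtr0_norm ?subr_gt0//; ring.
  - by rewrite subrr; ring.
(* [G] and [G'] live on opposite sides of v, so each is bounded by |G - G'|, whose integrability is
   known. *)
have GG' x : G x * G' x = 0.
  rewrite /G /G' /ppow !subr_gt0; case: ltgtP => _; rewrite ?mul0r ?mulr0 ?mul0r //.
have [i1 i2] := lintegrable_ppow fd v Dp.
have ilogn : lintegrable (fun x => `|spow_logslope p p (x - v) * f x|).
  by have := integrable_abse ilog.
have bnd x : `|G x| <= `|spow_logslope p p (x - v) * f x| /\
    `|G' x| <= `|spow_logslope p p (x - v) * f x|.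
  rewrite logE; have /eqP := GG' x; rewrite mulf_eq0 => /orP[]/eqP ->.
    by rewrite normr0 sub0r normrN.
  by rewrite normr0 subr0.
have mB : measurable_fun setT (fun x : R => x - v) by exact: measurable_funB.
have mB' : measurable_fun setT (fun x : R => v - x) by exact: measurable_funB.
have mG : measurable_fun setT G.
  apply: measurable_funM; first exact: (measurableT_comp (@measurable_ln R)).
  by apply: measurable_funM => //; exact: (measurableT_comp (measurable_ppow p)).
have mG' : measurable_fun setT G'.
  apply: measurable_funM; first exact: (measurableT_comp (@measurable_ln R)).
  by apply: measurable_funM => //; exact: (measurableT_comp (measurable_ppow p)).
have iG : lintegrable G by apply: lintegrable_le ilogn _ => // x; have [] := bnd x.
have iG' : lintegrable G' by apply: lintegrable_le ilogn _ => // x; have [] := bnd x.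
pose W x := ppow (x - v) p * f x; pose W' x := ppow (v - x) p * f x.
have ishift (g : R -> R) : lintegrable g -> lintegrable (fun y => g (v + y)).
  move=> ig; have := integrable_translation (- v) ig.
  by apply: eq_integrable => // y _ /=; rewrite opprK addrC.
have shift (g : R -> R) : lintegrable g -> lintegrable (fun y => H^-1 * g (v + y)) /\
    \int[lebesgue_measure]_y (H^-1 * g (v + y)) = H^-1 * \int[lebesgue_measure]_x g x.
  move=> ig; split; first by apply: lintegrableZ; exact: ishift.
  rewrite RintegralZl//; last exact: ishift.
  by rewrite Rintegral_translation//; case/integrableP : ig => /measurable_EFinP.
have refl (g : R -> R) : lintegrable g -> lintegrable (fun y => H^-1 * g (v - y)) /\
    \int[lebesgue_measure]_y (H^-1 * g (v - y)) = H^-1 * \int[lebesgue_measure]_x g x.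
  move=> ig; split; first by apply: lintegrableZ; exact: (integrable_reflection v ig).
  rewrite RintegralZl//; last exact: (integrable_reflection v ig).
  by rewrite Rintegral_reflection//; case/integrableP : ig => /measurable_EFinP.
have gpE : gplus f L Rb v p = (fun y => H^-1 * W (v + y)).
  by apply/funext => y; rewrite gplusE /W [v + y]addrC addrK.
have gmE : gminus f L v p = (fun y => H^-1 * W' (v - y)).
  by apply/funext => y; rewrite gminusE /W' opprB addrCA subrr addr0.
have gplnE : (fun y => ln y * gplus f L Rb v p y) = (fun y => H^-1 * G (v + y)).
  by apply/funext => y; rewrite gplusE /G [v + y]addrC addrK mulrCA.
have gmlnE : (fun y => ln y * gminus f L v p y) = (fun y => H^-1 * G' (v - y)).
  by apply/funext => y; rewrite gminusE /G' opprB addrCA subrr addr0 mulrCA.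
have ip : lintegrable (gplus f L Rb v p) by rewrite gpE; have [] := shift W i1.
have im : lintegrable (gminus f L v p) by rewrite gmE; have [] := refl W' i2.
have Hi0 : 0 < H^-1 by rewrite invr_gt0.
have Hi : 0 <= H^-1 by rewrite invr_ge0 ltW.
have p0 y : 0 <= gplus f L Rb v p y by rewrite gplusE !mulr_ge0 ?ppow_ge0.
have m0 y : 0 <= gminus f L v p y by rewrite gminusE !mulr_ge0 ?ppow_ge0.
have pneg y : y <= 0 -> gplus f L Rb v p y = 0.
  by move=> y0; rewrite gplusE /ppow ltNge y0 mul0r mulr0.
have mneg y : y <= 0 -> gminus f L v p y = 0.
  by move=> y0; rewrite gminusE /ppow ltNge y0 mul0r mulr0.
have lip : lintegrable (fun y => ln y * gplus f L Rb v p y).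
  by rewrite gplnE; have [] := shift G iG.
have lim : lintegrable (fun y => ln y * gminus f L v p y).
  by rewrite gmlnE; have [] := refl G' iG'.
have -> : \int[lebesgue_measure]_x (spow_logslope p p (x - v) * f x) =
    \int[lebesgue_measure]_x G x - \int[lebesgue_measure]_x G' x.
  by rewrite -RintegralB//; apply: eq_Rintegral => x _; exact: logE.
move=> pm; have mass : \int[lebesgue_measure]_y gplus f L Rb v p y =
    \int[lebesgue_measure]_y gminus f L v p y.
  rewrite gpE gmE (shift W i1).2 (refl W' i2).2; congr (_ * fine _).
  exact pm.
move=> /(Rintegral_ln_lt ip im p0 m0 pneg mneg mass lip lim).
rewrite gplnE gmlnE (shift G iG).2 (refl G' iG').2 (ltr_pM2l Hi0) subr_gt0.
exact.
Qed.

End dominance.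

(** * Monotonicity on the whole domain *)

Lemma pmean_within_continuous (R : realType) (f : R -> R) (L Rb : \bar R) (nu : R -> R)
    (q1 q2 : R) :
  interval_density f L Rb -> (forall q, pdomain f q -> is_pmean f q (nu q)) ->
  pdomain f q1 -> pdomain f q2 -> q1 < q2 -> {within `[q1, q2], continuous nu}.
Proof.
move=> fi nuE [q1_ge1 _] D2 q12.
have near12 p e : q1 <= p <= q2 -> 0 < e ->
    \forall q \near p, q1 <= q <= q2 -> `|nu p - nu q| < e.
  move=> pq e0; have p1 : 1 <= p <= q2 by lra.
  apply: filterS (pmean_continuous fi nuE D2 p1 e0) => q h qq.
  by rewrite distrC; apply: h; lra.
apply/(continuous_within_itvP _ q12); split.
- move=> p; rewrite in_itv/= => /andP[h1 h2]; apply/cvgrPdist_lt => e e0.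
  near=> q; have : q1 <= q <= q2.
    by apply/andP; split; apply/ltW; near: q; [exact: lt_nbhsr|exact: lt_nbhsl].
  by near: q; apply: near12 => //; lra.
- apply/cvgrPdist_lt => e e0.
  near=> q; have : q1 <= q <= q2.
    by apply/andP; split; near: q; [exact: nbhs_right_ge|exact: nbhs_right_le].
  by near: q; apply: cvg_within; apply: near12 => //; lra.
- apply/cvgrPdist_lt => e e0.
  near=> q; have : q1 <= q <= q2.
    by apply/andP; split; near: q; [exact: nbhs_left_ge|exact: nbhs_left_le].
  by near: q; apply: cvg_within; apply: near12 => //; lra.
Unshelve. all: by end_near.
Qed.

Theorem theorem1 (R : realType) (f : R -> R) (L Rb : \bar R) (nu : R -> R) :
  is_density f ->
  (L < Rb)%E ->
  (forall x, ~ (L < x%:E < Rb)%E -> f x = 0) ->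
  (forall x, (L < x%:E < Rb)%E ->
     forall e : R, 0 < e -> exists y, `|y - x| < e /\ 0 < f y) ->
  (forall x, (L < x%:E < Rb)%E -> {for x, continuous f}) ->
  (forall q, pdomain f q -> is_pmean f q (nu q)) ->
  (forall p : R, interior (pdomain f) p ->
     strict_dominance (gplus f L Rb (nu p) p) (gminus f L (nu p) p) ->
     exists2 d : R, 0 < d & is_derive p 1 nu d)
  /\
  ((exists p : R, interior (pdomain f) p) ->
   (forall p : R, interior (pdomain f) p ->
      strict_dominance (gplus f L Rb (nu p) p) (gminus f L (nu p) p)) ->
   truly_pos_skewed f nu).
Proof.
move=> fd LR supp dense cont nuE.
have fi : interval_density f L Rb by split.
have deriv p : interior (pdomain f) p ->
    strict_dominance (gplus f L Rb (nu p) p) (gminus f L (nu p) p) ->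
    exists2 d : R, 0 < d & is_derive p 1 nu d.
  move=> iDp dom; have pm := nuE p (nbhs_singleton iDp).
  have nuLR := pmean_in_support fi (nbhs_singleton iDp) pm.
  eexists; last exact: (is_derive_pmean fi nuE iDp).
  apply: divr_gt0; first exact: (spow_logslope_integral_gt0 fi iDp pm dom).
  exact: (spow_slope_integral_gt0 fi iDp nuLR).
split; first exact: deriv.
move=> iD dom; split; first exact: iD.
move=> q1 q2 D1 D2 q12.
have q1_ge1 : 1 <= q1 by case: D1.
(* By [pdomain_le] the domain contains everything between q1 and q2, so these p are interior even if
   q1 or q2 is an endpoint. *)
have d12 p : p \in `]q1, q2[ -> exists2 d : R, 0 < d & is_derive p 1 nu d.
  rewrite in_itv/= => /andP[h1 h2]; suff iDp : interior (pdomain f) p by apply: deriv => //; exact: dom.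
  near=> q; apply: (@pdomain_le _ _ fd _ q2) => //; apply/andP; split.
    by rewrite (le_trans q1_ge1)// ltW//; near: q; exact: lt_nbhsr.
  by apply/ltW; near: q; exact: lt_nbhsl.
apply: (@gtr0_derive1_lt_cc _ nu q1 q2) => //.
- by move=> p /d12[d _ []].
- by move=> p /d12[d d0 [_ dE]]; rewrite derive1E dE.
- exact: (pmean_within_continuous fi nuE D1 D2 q12).
- by rewrite in_itv/= lexx ltW.
- by rewrite in_itv/= lexx ltW.
Unshelve. all: by end_near.
Qed.
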